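(* Let $\mathcal{G}\rightrightarrows M$ be a Lie groupoid with Lie algebroid $A$ and anchor $\rho$. If a bundle of ideals $\mathfrak{k}\subset A$ of $\mathcal{G}$ is partially split, then for each $x\in M$ the isotropy Lie algebra $\mathfrak{g}_x=\ker\rho_x$ splits into a direct sum of ideals $$\mathfrak{g}_x=\mathfrak{k}_x\oplus\mathfrak{l}_x,$$ that is, there is an ideal $\mathfrak{l}_x\subset\mathfrak{g}_x$ complementary to the ideal $\mathfrak{k}_x$.
   Context: Conventions: source $s$, target $t$, multiplication defined on pairs $(g,h)$ with $s(g)=t(h)$; $\mathcal{G}$ need not be Hausdorff; $A=\ker(dt)|_M$ with bracket of left-invariant vector fields and anchor $\rho=ds|_A$. For $x\in M$, $\ker\rho_x$ is the Lie algebra of the isotropy group $\mathcal{G}_x$; an arrow $g$ acts by $\mathrm{Ad}_g:\ker\rho_{s(g)}\to\ker\rho_{t(g)}$, the differential at the unit of $h\mapsto ghg^{-1}$. A bundle of ideals of $\mathcal{G}$ is a vector subbundle $\mathfrak{k}\subset A$ with $\mathfrak{k}\subset\ker\rho$ and $\mathrm{Ad}_g(\mathfrak{k}_{s(g)})=\mathfrak{k}_{t(g)}$ for all $g$. Put $K_g:=dL_g(\mathfrak{k}_{s(g)})=dR_g(\mathfrak{k}_{t(g)})$. $\mathfrak{k}$ is partially split if there is a vector subbundle $E\subset T\mathcal{G}$ which is a wide Lie subgroupoid $E\rightrightarrows TM$ of the tangent groupoid $T\mathcal{G}\rightrightarrows TM$ (structure maps the differentials of those of $\mathcal{G}$) with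 $T\mathcal{G}=E\oplus K$. *)

(* Defs.v *)
From HB Require Import structures.
From mathcomp Require Export all_boot all_order all_algebra.
From mathcomp Require Export all_classical all_reals all_analysis.
Export numFieldNormedType.Exports.

Set Implicit Arguments.
Unset Strict Implicit.
Unset Printing Implicit Defensive.

Local Open Scope classical_set_scope.
Local Open Scope ring_scope.

Section Smooth.
Context {R : realType}.

Fixpoint Ck_on {V W : normedModType R} (k : nat) (U : set V) (f : V -> W) :
    Prop :=
  match k with
  | 0 => forall x, U x -> {for x, continuous f}
  | k'.+1 => (forall x, U x -> differentiable f x) /\
             (forall v, Ck_on k' U (fun x => 'D_v f x))
  end.

Definition smooth_on {V W : normedModType R} (U : set V) (f : V -> W) : Prop :=
  forall k, Ck_on k U f.

Definition smooth_at {V W : normedModType R} (f : V -> W) (x : V) : Prop :=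
  exists U : set V, [/\ open U, U x & smooth_on U f].

(* A map [f] defined on a subset [S] (typically an embedded submanifold), read
   in the coordinates [phi] on the source and [psi] on the target, is smooth at
   [p] if near [p] it is the restriction to [S] of a smooth map [F] between open
   subsets of the coordinate spaces.  The differential of [f] at [p] is the
   restriction of ['d F] to the tangent space of [S]; it does not depend on [F],
   but its values on vectors that are not tangent to [S] do. *)
Definition local_extension {T T' : topologicalType} {V W : normedModType R}
    (S : set T) (phi : T -> V) (psi : T' -> W) (f : T -> T') (p : T)
    (F : V -> W) : Prop :=
  smooth_at F (phi p) /\
  \forall a \near within S (nbhs p), psi (f a) = F (phi a).

Definition smooth_within {T T' : topologicalType} {V W : normedModType R}
    (S : set T) (phi : T -> V) (psi : T' -> W) (f : T -> T') (p : T) : Prop :=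
  f @ within S (nbhs p) --> f p /\
  exists F, local_extension S phi psi f p F.

Definition diff_within {T T' : topologicalType} {V W : normedModType R}
    (S : set T) (phi : T -> V) (psi : T' -> W) (f : T -> T') (p : T)
    (v : V) (w : W) : Prop :=
  exists F, local_extension S phi psi f p F /\ w = 'd F (phi p) v.

End Smooth.

Record chart (R : realType) (T : topologicalType) (n : nat) := Chart {
  chart_dom : set T;
  chart_map :> T -> 'rV[R]_n;
  chart_inv : 'rV[R]_n -> T;
  open_chart_dom : open chart_dom;
  open_chart_img : open (chart_map @` chart_dom);
  chart_mapK : forall p, chart_dom p -> chart_inv (chart_map p) = p;
  chart_map_continuous : forall p, chart_dom p -> {for p, continuous chart_map};
  chart_inv_continuous : forall p, chart_dom p ->
    {for chart_map p, continuous chart_inv}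
}.

(* The atlas is indexed by the points of the manifold, the chart [chart_at p]
   being defined at [p]; every smooth structure has such an atlas.
   Manifolds are second countable, but need not be Hausdorff. *)
Record manifold (R : realType) := Manifold {
  mcarrier :> topologicalType;
  mdim : nat;
  chart_at : mcarrier -> chart R mcarrier mdim;
  chart_at_dom : forall p, chart_dom (chart_at p) p;
  chart_compat : forall p q,
    smooth_on (chart_at p @` (chart_dom (chart_at p) `&` chart_dom (chart_at q)))
      (chart_at q \o chart_inv (chart_at p));
  manifold_second_countable : @second_countable mcarrier
}.

(* The tangent space at [p] is the coordinate space: a tangent vector at [p] is
   given by its coordinates in the preferred chart [chart_at p]. *)
Definition tangent {R : realType} (M : manifold R) (p : M) := 'rV[R]_(mdim M).
Arguments tangent {R M} p /.

Unset Implicit Arguments.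

Section Manifold.
Context {R : realType}.

Definition smooth_map {M N : manifold R} (f : M -> N) : Prop :=
  forall p, smooth_within setT (chart_at p) (chart_at (f p)) f p.

Definition mdiff {M N : manifold R} (f : M -> N) (p : M) :
    'Hom(tangent p, tangent (f p)) :=
  linfun ('d (chart_at (f p) \o f \o chart_inv (chart_at p)) (chart_at p p)).

Definition mdiff_within {M N : manifold R} (S : set M) (f : M -> N) (p : M)
    (v : tangent p) (w : tangent (f p)) : Prop :=
  diff_within S (chart_at p) (chart_at (f p)) f p v w.

Definition submersion {M N : manifold R} (f : M -> N) : Prop :=
  smooth_map f /\ forall p, limg (mdiff f p) = fullv.

(* The coordinates in the chart [chart_at p] of a tangent vector at [q]. *)
Definition tangent_coord {M : manifold R} (p q : M) (v : tangent q) :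
    'rV[R]_(mdim M) :=
  'd (chart_at p \o chart_inv (chart_at q)) (chart_at q q) v.

(* A section of the pullback bundle [f^* TN]. *)
Definition smooth_section_at {M N : manifold R} (f : M -> N)
    (X : forall x : M, tangent (f x)) (x : M) : Prop :=
  smooth_within setT (chart_at x) id
    (fun y => tangent_coord (f x) (f y) (X y)) x.

Definition smooth_section {M N : manifold R} (f : M -> N)
    (X : forall x : M, tangent (f x)) : Prop :=
  forall x, smooth_section_at f X x.

(* A vector subbundle of [f^* TN]. *)
Definition subbundle {M N : manifold R} (f : M -> N)
    (V : forall x : M, {vspace tangent (f x)}) : Prop :=
  forall x, exists (r : nat) (X : 'I_r -> forall y : M, tangent (f y)),
    (forall i, smooth_section_at f (X i) x) /\
    \forall y \near x, basis_of (V y) [tuple X i y | i < r].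

Definition vector_field (M : manifold R) := forall p : M, tangent p.

Definition field_coord {M : manifold R} (p : M) (X : vector_field M)
    (y : 'rV[R]_(mdim M)) : 'rV[R]_(mdim M) :=
  let q := chart_inv (chart_at p) y in tangent_coord p q (X q).

Definition lie_bracket {M : manifold R} (X Y : vector_field M) :
    vector_field M :=
  fun p => 'D_(X p) (field_coord p Y) (chart_at p p) -
           'D_(Y p) (field_coord p X) (chart_at p p).

End Manifold.

Set Implicit Arguments.

(* [mul g h] is meaningful only if [src g = tgt h].  The charts of [G * G] used
   for the smoothness of the multiplication are products of charts of [G]. *)
Record lie_groupoid (R : realType) := LieGroupoid {
  arrows : manifold R;
  objects : manifold R;
  src : arrows -> objects;
  tgt : arrows -> objects;
  one : objects -> arrows;
  inv : arrows -> arrows;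
  mul : arrows -> arrows -> arrows;
  composable : set (arrows * arrows) := [set gh | src gh.1 = tgt gh.2];
  objects_hausdorff : hausdorff_space objects;
  src_submersion : submersion src;
  tgt_submersion : submersion tgt;
  one_smooth : smooth_map one;
  inv_smooth : smooth_map inv;
  mul_smooth : forall g h, src g = tgt h ->
    smooth_within composable
      (fun ab => (chart_at g ab.1, chart_at h ab.2)) (chart_at (mul g h))
      (fun ab => mul ab.1 ab.2) (g, h);
  src_one : forall x, src (one x) = x;
  tgt_one : forall x, tgt (one x) = x;
  src_inv : forall g, src (inv g) = tgt g;
  tgt_inv : forall g, tgt (inv g) = src g;
  src_mul : forall g h, src g = tgt h -> src (mul g h) = src h;
  tgt_mul : forall g h, src g = tgt h -> tgt (mul g h) = tgt g;
  mulA : forall g h k, src g = tgt h -> src h = tgt k ->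
    mul g (mul h k) = mul (mul g h) k;
  mul1g : forall g, mul (one (tgt g)) g = g;
  mulg1 : forall g, mul g (one (src g)) = g;
  mulVg : forall g, mul (inv g) g = one (src g);
  mulgV : forall g, mul g (inv g) = one (tgt g)
}.

Unset Implicit Arguments.

Section LieGroupoid.
Context {R : realType} {G : lie_groupoid R}.
Local Notation Arr := (arrows G).
Local Notation Obj := (objects G).

(* All tangent spaces of a manifold are the same coordinate space, and equal
   points have the same preferred chart.  So vectors at [src g] and at [tgt h]
   can be compared when [src g = tgt h], and a vector at [mul g (one (src g))]
   is also a vector at [g]. *)

(* The multiplication of the tangent groupoid: [w] is the product of the vectors
   [u] at [g] and [v] at [h]. *)
Definition tangent_mul (g h : Arr) (u : tangent g) (v : tangent h)
    (w : tangent (mul g h)) : Prop :=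
  diff_within (@composable R G)
    (fun ab : Arr * Arr => (chart_at g ab.1, chart_at h ab.2))
    (chart_at (mul g h)) (fun ab => mul ab.1 ab.2) (g, h) (u, v) w.

Definition tgt_fiber (x : Obj) : set Arr := [set h | tgt h = x].

Definition isotropy_group (x : Obj) : set Arr :=
  [set h | src h = x /\ tgt h = x].

(* [dL_g : A_(src g) -> T_g G] *)
Definition diff_left (g : Arr) (v : tangent (one (src g))) (w : tangent g) :
    Prop :=
  mdiff_within (tgt_fiber (src g)) (mul g) (one (src g)) v w.

(* [Ad_g : ker rho_(src g) -> ker rho_(tgt g)] *)
Definition Ad (g : Arr) (v : tangent (one (src g)))
    (w : tangent (one (tgt g))) : Prop :=
  mdiff_within (isotropy_group (src g)) (fun h => mul (mul g h) (inv g))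
    (one (src g)) v w.

Definition algebroid (x : Obj) : {vspace tangent (one x)} :=
  lker (mdiff (@tgt R G) (one x)).

Definition algebroid_section (a : forall x : Obj, tangent (one x)) : Prop :=
  smooth_section (@one R G) a /\ forall x, a x \in algebroid x.

(* [ker rho_x], the anchor [rho] being the restriction of [d src] to [A] *)
Definition isotropy_algebra (x : Obj) : {vspace tangent (one x)} :=
  (algebroid x :&: lker (mdiff (@src R G) (one x)))%VS.

Definition left_invariant_field (a : forall x : Obj, tangent (one x))
    (X : vector_field Arr) : Prop :=
  smooth_section id X /\ forall g, diff_left g (a (src g)) (X g).

(* [w] is the bracket of [u] and [v] in [ker rho_x]: the value at [x] of the
   bracket of two sections of [A] extending [u] and [v]. *)
Definition isotropy_bracket (x : Obj) (u v w : tangent (one x)) : Prop :=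
  exists (a b : forall y : Obj, tangent (one y)) (X Y : vector_field Arr),
    [/\ algebroid_section a /\ algebroid_section b,
        a x = u /\ b x = v,
        left_invariant_field a X /\ left_invariant_field b Y &
        w = lie_bracket X Y (one x)].

Definition isotropy_ideal (x : Obj) (l : {vspace tangent (one x)}) : Prop :=
  (l <= isotropy_algebra x)%VS /\
  forall u v w, u \in isotropy_algebra x -> v \in l ->
    isotropy_bracket x u v w -> w \in l.

Definition bundle_of_ideals (k : forall x : Obj, {vspace tangent (one x)}) :
    Prop :=
  [/\ subbundle (@one R G) k,
      forall x, (k x <= isotropy_algebra x)%VS &
      forall g w, w \in k (tgt g) <->
        exists v, v \in k (src g) /\ Ad g v w].

(* [K_g = dL_g (k_(src g))] *)
Definition translated_bundle (k : forall x : Obj, {vspace tangent (one x)})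
    (g : Arr) : set (tangent g) :=
  [set w | exists v, v \in k (src g) /\ diff_left g v w].

(* A vector subbundle of [TG] that is a wide Lie subgroupoid over [TM].  The
   source and target of such a subgroupoid are morphisms of vector bundles over
   submersions, so they are submersions as soon as they are fiberwise onto. *)
Record wide_lie_subgroupoid (E : forall g : Arr, {vspace tangent g}) : Prop :=
  WideLieSubgroupoid {
  wide_subbundle : subbundle id E;
  wide_one : forall x (v : tangent x), mdiff (@one R G) x v \in E (one x);
  wide_inv : forall g v, v \in E g -> mdiff (@inv R G) g v \in E (inv g);
  wide_mul : forall g h (u : tangent g) (v : tangent h) (w : tangent (mul g h)),
    src g = tgt h -> u \in E g -> v \in E h ->
    mdiff (@src R G) g u = mdiff (@tgt R G) h v ->
    tangent_mul g h u v w -> w \in E (mul g h);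
  wide_src : forall g, (mdiff (@src R G) g @: E g)%VS = fullv;
  wide_tgt : forall g, (mdiff (@tgt R G) g @: E g)%VS = fullv
}.

Definition partially_split (k : forall x : Obj, {vspace tangent (one x)}) :
    Prop :=
  exists E : forall g : Arr, {vspace tangent g},
    wide_lie_subgroupoid E /\
    forall g,
      (forall u : tangent g, exists e w,
         [/\ e \in E g, translated_bundle k g w & u = e + w]) /\
      (forall u : tangent g, u \in E g -> translated_bundle k g u -> u = 0).

End LieGroupoid.

(* Main.v *)
(* Take l_x = E_(1_x) /\ g_x.  Vectors of g_x are velocities of curves in the
   isotropy group G_x: the restriction of s to the t-fibre of x has constant rank
   because right translation by an arrow g of that fibre maps g_x injectively into
   ker ds /\ ker dt at g.  Multiplying such curves by g and g^-1 shows that l_x,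
   like k_x, is stable under Ad_g for g in G_x: E is closed under the
   multiplication of TG and contains the zero vectors.

   A subspace l of g_x stable under Ad_(G_x) is an ideal.  Let m be the
   multiplication in the chart at 1_x.  The left-invariant field of v is
   d_2 m(g, 1) v at the arrows g with source x, so that
   [u, v] = d_1 d_2 m(u; v) - d_1 d_2 m(v; u), and by the symmetry of second
   derivatives this is, up to sign, the derivative at 0 of
   d_1 m(1, c) v - d_2 m(c, 1) v along a curve c in G_x of velocity u.  By
   invariance d_1 m(1, c) v lies in d_2 m(c, 1) l, and d_2 m(c, 1) tends to the
   identity of l, so that the derivative lies in l. *)

From HB Require Import structures.
From mathcomp Require Import ring lra.
Require Import Defs.

Set Implicit Arguments.
Unset Strict Implicit.
Unset Printing Implicit Defensive.
Import Order.TTheory GRing.Theory Num.Theory.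
Local Open Scope classical_set_scope.
Local Open Scope ring_scope.

(** * Differential calculus *)

Section Calculus.
Context {R : realType}.

(** The differentials of maps defined on subsets of G ([diff_left], [Ad], [tangent_mul]) are
    relations given by an arbitrary smooth extension, and their values are meaningful only on
    vectors tangent to the subset. Such vectors are therefore represented by curves lying in the
    subset, and identities between differentials are read off from identities between products of
    arrows, differentiated at 0. The obstacle is to find these curves in G_x, which is not given as
    a submanifold: s and t together need not form a submersion at the unit, so that being killed by
    both differentials there does not by itself produce a curve. In the last step the conjugate
    vector is chosen separately for each arrow, so the membership of the derivative in l must come
    from an estimate that asks nothing about how this choice varies. *)

Lemma is_derive1_diff_comp (V W : normedModType R) (c : R -> V) (F : V -> W)
    (t : R) (v : V) :
  differentiable F (c t) -> is_derive t 1 c v ->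
  is_derive t 1 (F \o c) ('d F (c t) v).
Proof.
move=> dF [dc cv].
have dc' : differentiable c t by apply/derivable1_diffP.
have dFc : differentiable (F \o c) t by exact: differentiable_comp.
split; first exact/derivable1_diffP.
by rewrite deriveE// diff_comp//= -cv deriveE.
Qed.

Lemma is_derive_uniq (V W : normedModType R) (f : V -> W) (x v : V) (a b : W) :
  is_derive x v f a -> is_derive x v f b -> a = b.
Proof. by move=> [_ <-] [_ <-]. Qed.

Lemma is_derive_pair (V W : normedModType R) (c : R -> V) (d : R -> W) (t : R)
    (v : V) (w : W) :
  is_derive t 1 c v -> is_derive t 1 d w ->
  is_derive t 1 (fun s => (c s, d s)) (v, w).
Proof.
move=> [dc cv] [dd dw].
have fc : differentiable c t by apply/derivable1_diffP.
have fd : differentiable d t by apply/derivable1_diffP.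
have fcd := differentiable_pair fc fd.
split; first exact/derivable1_diffP.
by rewrite deriveE// diff_pair// -cv -dw !deriveE.
Qed.

Lemma differentiable_near_le (V W : normedModType R) (f : V -> W) (x : V) :
  differentiable f x -> forall e : R, 0 < e ->
  \forall y \near x, `|f y - f x - 'd f x (y - x)| <= e * `|y - x|.
Proof.
move=> /diff_locallyx dfx e e0.
have sub2 (a b c : W) : a + b + c - a - b = c.
  by rewrite -addrA -opprD (addrC (a + b)) addrK.
have : \forall h \near (0 : V), `|f (h + x) - f x - 'd f x h| <= e * `|h|.
  by near=> h; rewrite dfx sub2; near: h; exact: littleoP.
rewrite (near_shift x)/= => H; near=> y.
rewrite -[in f y](subrK x y).
suff : (fun y => `|f (y - x + x) - f x - 'd f x (y - x)| <= e * `|y - x|) y by [].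
near: y; move: H; apply: filterS => y /=.
by rewrite sub0r.
Unshelve. all: by end_near. Qed.

Lemma is_diff_le (V W : normedModType R) (f : V -> W) (x : V)
    (L : {linear V -> W}) :
  continuous L ->
  (forall e : R, 0 < e ->
     \forall y \near x, `|f y - f x - L (y - x)| <= e * `|y - x|) ->
  is_diff x f L.
Proof.
move=> cL H.
have E : f \o shift x = cst (f x) + L +o_ 0 id.
  apply/eqaddoP => e e0; rewrite near_simpl.
  have := H _ e0; rewrite (near_shift 0)/=; apply: filterS => h /=.
  by rewrite subr0 addrK !fctE /= opprD addrA.
have dE := diff_unique cL E.
by split=> //; apply/diff_locallyP; rewrite dE.
Qed.

Lemma is_diff_near_eq (V W : normedModType R) (f g : V -> W) (x : V) :
  (\forall y \near x, f y = g y) -> differentiable f x -> is_diff x g ('d f x).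
Proof.
move=> fg df; apply: is_diff_le => [|e e0]; first exact: diff_continuous.
have fgx : f x = g x := nbhs_singleton fg.
have H := differentiable_near_le df e0.
near=> y; rewrite -fgx -(near fg y)//; exact: (near H y).
Unshelve. all: by end_near. Qed.

Lemma is_derive_line (V W : normedModType R) (f : V -> W) (a u : V) (s : R) :
  derivable f (a + s *: u) u ->
  is_derive s 1 (fun s => f (a + s *: u)) ('D_u f (a + s *: u)).
Proof.
move=> fu.
have E : (fun h : R => h^-1 *: (((fun s => f (a + s *: u)) \o shift s) (h *: 1)
      - f (a + s *: u))) =
    (fun h => h^-1 *: ((f \o shift (a + s *: u)) (h *: u) - f (a + s *: u))).
  apply/funext => h /=; congr (_ *: (f _ - _)).
  by rewrite [h *: 1]mulr1 scalerDl addrCA.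
by split; [rewrite /derivable E | rewrite /derive E].
Qed.

Lemma is_derive_scalel (W : normedModType R) (w : W) (s : R) :
  is_derive s 1 (fun s => s *: w) w.
Proof.
have := is_derive_line (@derivable_id _ _ (0 + s *: w) w).
rewrite derive_id (_ : (fun s => id _) = (fun s => s *: w))//.
by apply/funext => h; rewrite add0r.
Qed.

Lemma is_derive_le (V : normedModType R) (c : R -> V) (t : R) (v : V) :
  (forall e : R, 0 < e -> exists2 d : R, 0 < d & forall s, `|s - t| < d ->
     `|c s - c t - (s - t) *: v| <= e * `|s - t|) ->
  is_derive t 1 c v.
Proof.
move=> H; pose L (h : R) := h *: v.
have lin : linear L by move=> ? ? ?; rewrite /L scalerDl scalerA.
pose lm := GRing.isLinear.Build _ _ _ _ _ lin.
pose Ll : {linear R -> V} := HB.pack L lm.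
have [||dc dE] := @is_diff_le _ _ c t Ll; first exact: scalel_continuous.
  move=> e /H[d d0 dP]; apply/nbhs_normP; exists d => // s.
  by rewrite /ball_/= distrC => /dP.
by split; [exact/derivable1_diffP|rewrite deriveE// dE /= /L scale1r].
Qed.

Lemma near_ex_ball (V : normedModType R) (p : V) (P : set V) :
  nbhs p P -> exists2 d : R, 0 < d & forall z, `|z - p| < d -> P z.
Proof.
move=> /nbhs_normP[d /= d0 H]; exists d => // z zp.
by apply: H; rewrite /ball_/= distrC.
Qed.

Lemma nbhs_norm_lt (V : normedModType R) (p : V) (d : R) :
  0 < d -> \forall z \near p, `|z - p| < d.
Proof.
by move=> d0; apply/nbhs_normP; exists d => // z; rewrite /ball_/= distrC.
Qed.

Lemma near_pair_l (V : normedModType R) (a b : V) (P : set (V * V)) :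
  nbhs (a, b) P -> \forall y \near a, P (y, b).
Proof.
move=> nP; have : (fun y : V => (y, b)) @ a --> (a, b).
  by apply: cvg_pair; [exact: cvg_id|exact: cvg_cst].
by apply.
Qed.

Lemma near_pair_r (V : normedModType R) (a b : V) (P : set (V * V)) :
  nbhs (a, b) P -> \forall y \near b, P (a, y).
Proof.
move=> nP; have : (fun y : V => (a, y)) @ b --> (a, b).
  by apply: cvg_pair; [exact: cvg_cst|exact: cvg_id].
by apply.
Qed.

Lemma near_and4 (T : topologicalType) (p : T) (A B C D : set T) :
  nbhs p A -> nbhs p B -> nbhs p C -> nbhs p D ->
  \forall q \near p, [/\ A q, B q, C q & D q].
Proof. by move=> a b c d; apply: filterS3 (filterI a b) c d => q []. Qed.

(** * Second differences and the mean value inequality *)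

(** For fixed h, the second difference is the increment over [0, h] of s |-> f (p + h v + s u) - f
    (p + s u). The mean value theorem turns it into h times a difference of two values of ['D_u f];
    each is expanded to first order at [p], and the terms in s u cancel. *)
Lemma second_difference (V : normedModType R) (f : V -> R) (p u v : V) :
  (\forall z \near p, derivable f z u) ->
  differentiable (fun z => 'D_u f z) p ->
  forall e : R, 0 < e -> exists2 d : R, 0 < d & forall h : R, 0 < h < d ->
  `|f (p + h *: v + h *: u) - f (p + h *: v) - f (p + h *: u) + f p
    - h ^+ 2 * 'd (fun z => 'D_u f z) p v| <= e * h ^+ 2.
Proof.
move=> fu dDf e e0.
(* Both expansions are at points within h (|u| + |v|) of [p], so their errors add up to at most 2 h
   (|u| + |v|) e / C; the 1 keeps [C] positive. *)
pose C : R := 2 * (`|u| + `|v|) + 1.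
have C0 : 0 < C by rewrite ltr_wpDl// mulr_ge0// addr_ge0.
have eC0 : 0 < e / C by rewrite divr_gt0.
have [d d0 H] := near_ex_ball (filterI fu (differentiable_near_le dDf eC0)).
exists (d / C); first by rewrite divr_gt0.
move=> h /andP[h0 hd].
have hC : h * C < d by rewrite -ltr_pdivlMr.
set L := 'd _ p.
have near1 (s t : R) : 0 <= s <= h -> 0 <= t <= h ->
    `|s *: u + t *: v| <= h * (`|u| + `|v|).
  move=> /andP[s0 sh] /andP[t0 th].
  rewrite (le_trans (ler_normD _ _))// !normrZ !ger0_norm// mulrDr.
  by rewrite lerD// ler_wpM2r.
have near2 (s t : R) : 0 <= s <= h -> 0 <= t <= h ->
    `|s *: u + t *: v| < d.
  move=> s0 t0; rewrite (le_lt_trans (near1 _ _ s0 t0))//.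
  rewrite (le_lt_trans _ hC)// ler_wpM2l ?(ltW h0)// /C.
  rewrite (@le_trans _ _ (2 * (`|u| + `|v|)))// ?lerDl//.
  by rewrite ler_peMl ?addr_ge0// ler1n.
have near3 (s t : R) : 0 <= s <= h -> 0 <= t <= h ->
    `|p + (s *: u + t *: v) - p| < d.
  by move=> s0 t0; rewrite addrAC subrr add0r near2.
have h00 : 0 <= h <= h by rewrite lexx ltW.
have h01 : 0 <= (0 : R) <= h by rewrite lexx ltW.
pose g s := f (p + h *: v + s *: u) - f (p + s *: u).
have gE s : 0 <= s <= h -> is_derive s 1 g
    ('D_u f (p + h *: v + s *: u) - 'D_u f (p + s *: u)).
  move=> s0; apply: is_deriveB.
  - apply: is_derive_line.
    by have [+ _] := H _ (near3 _ _ s0 h00); rewrite (addrC (s *: u)) addrA.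
  - apply: is_derive_line.
    by have [+ _] := H _ (near3 _ _ s0 h01); rewrite scale0r addr0.
have [||s sI] := @MVT _ g
  (fun s => 'D_u f (p + h *: v + s *: u) - 'D_u f (p + s *: u)) 0 h h0.
- by move=> s sI; apply: gE; rewrite !ltW// (itvP sI).
- apply: derivable_within_continuous => s sI.
  by have [] := gE s (ltac:(by rewrite !(itvP sI))).
- have s0h : 0 <= s <= h by rewrite !ltW// (itvP sI).
  have [_ B1] := H _ (near3 _ _ s0h h00); have [_ B2] := H _ (near3 _ _ s0h h01).
  rewrite subr0 /g !scale0r !addr0 => gh.
  have -> : f (p + h *: v + h *: u) - f (p + h *: v) - f (p + h *: u) + f p =
      (f (p + h *: v + h *: u) - f (p + h *: u)) - (f (p + h *: v) - f p).
    by ring.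
  rewrite gh.
  have pE w : p + w - p = w by rewrite addrAC subrr add0r.
  have LE : L (s *: u + h *: v) = L (s *: u) + h * L v.
    by rewrite linearD [L (h *: v)]linearZ.
  have n1 := near1 _ _ s0h h00; have n2 := near1 _ _ s0h h01.
  move: B1 B2; rewrite !pE -/L LE.
  rewrite scale0r addr0 in n2 *; rewrite (addrC (s *: u)) addrA.
  rewrite (addrC (s *: u)) in n1.
  set D1 := 'D_u f _; set D0 := 'D_u f p; set D2 := 'D_u f (p + _) => B1 B2.
  have {}B1 := le_trans B1 (ler_wpM2l (ltW eC0) n1).
  have {}B2 := le_trans B2 (ler_wpM2l (ltW eC0) n2).
  have -> : (D1 - D2) * h - h ^+ 2 * L v =
      ((D1 - D0 - (L (s *: u) + h * L v)) - (D2 - D0 - L (s *: u))) * h.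
    by ring.
  rewrite normrM (gtr0_norm h0) expr2 mulrA ler_wpM2r ?(ltW h0)//.
  rewrite (le_trans (ler_normB _ _))// (le_trans (lerD B1 B2))//.
  rewrite -mulrDr -mulrA ler_wpM2l ?(ltW e0)// mulrC ler_pdivrMr//.
  rewrite -mulrDr ler_wpM2l ?(ltW h0)// /C -mulr2n mulr_natl.
  by rewrite lerDl.
Qed.

(** The second difference is symmetric in [u] and [v], so h^2 times either mixed derivative
    approximates it within h^2 e / 2 for one small h. *)
Lemma schwarz (V : normedModType R) (f : V -> R) (p u v : V) :
  (\forall z \near p, derivable f z u) ->
  (\forall z \near p, derivable f z v) ->
  differentiable (fun z => 'D_u f z) p ->
  differentiable (fun z => 'D_v f z) p ->
  'D_v (fun z => 'D_u f z) p = 'D_u (fun z => 'D_v f z) p.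
Proof.
move=> fu fv dfu dfv; rewrite !deriveE//.
pose a : R := 'd (fun z => 'D_u f z) p v; pose b : R := 'd (fun z => 'D_v f z) p u.
suff : a = b by [].
apply/eqP; rewrite -subr_eq0 -normr_le0; apply/ler_addgt0Pr => e e0.
rewrite add0r.
have e20 : 0 < e / 2 by rewrite divr_gt0.
have [d1 d10 H1] := @second_difference _ _ _ _ v fu dfu _ e20.
have [d2 d20 H2] := @second_difference _ _ _ _ u fv dfv _ e20.
pose h := Num.min d1 d2 / 2.
have m0 : 0 < Num.min d1 d2 by rewrite lt_min d10.
have h0 : 0 < h by rewrite divr_gt0.
have hm : h < Num.min d1 d2 by rewrite ltr_pdivrMr// ltr_pMr// ltr1n.
have h1 : 0 < h < d1 by rewrite h0 (lt_le_trans hm)// ge_min lexx.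
have h2 : 0 < h < d2 by rewrite h0 (lt_le_trans hm)// ge_min lexx orbT.
have B : `|f (p + h *: v + h *: u) - f (p + h *: v) - f (p + h *: u) + f p
    - h ^+ 2 * a| <= e / 2 * h ^+ 2 := H1 h h1.
have A : `|f (p + h *: v + h *: u) - f (p + h *: u) - f (p + h *: v) + f p
    - h ^+ 2 * b| <= e / 2 * h ^+ 2.
  by rewrite (addrAC p (h *: v) (h *: u)); exact: H2 h h2.
have h20 : 0 < h ^+ 2 by rewrite exprn_gt0.
rewrite -(ler_pM2l h20) -{1}(gtr0_norm h20) -normrM.
move: A B; move: (f (p + _ + _)) (f (p + _)) (f (p + _)) (f p).
move=> x1 x2 x3 x4 A B.
have -> : h ^+ 2 * (a - b) = (x1 - x3 - x2 + x4 - h ^+ 2 * b) -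
    (x1 - x2 - x3 + x4 - h ^+ 2 * a) by ring.
rewrite (le_trans (ler_normB _ _))// (le_trans (lerD A B))//.
by rewrite -mulrDl -splitr mulrC.
Qed.

Lemma rV_norm_le k (x : 'rV[R]_k) (M : R) :
  0 <= M -> (forall j, `|x ord0 j| <= M) -> `|x| <= M.
Proof.
move=> M0 xM; rewrite [`|x|]/Num.Def.normr/= mx_normrE.
by apply: bigmax_le => //= -[i j] _; rewrite /= ord1.
Qed.

Lemma rV_coord_le k (x : 'rV[R]_k) j : `|x ord0 j| <= `|x|.
Proof.
rewrite [leRHS]/Num.Def.normr/= mx_normrE.
exact: (le_bigmax _ (fun i : 'I_1 * 'I_k => `|x i.1 i.2|) (ord0, j)).
Qed.

Lemma is_derive_coord (V : normedModType R) k (f : V -> 'rV[R]_k) (x v : V) df j :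
  is_derive x v f df -> is_derive x v (fun y => f y ord0 j) (df ord0 j).
Proof.
move=> [fv <-]; split; first exact: (derivable_mxP _ _ _).1.
by rewrite derive_mx// mxE.
Qed.

(** The norm of a row is the maximum of its coordinates, so the scalar mean value theorem in each
    coordinate is enough, the intermediate point depending on the coordinate. *)
Lemma mean_value_le k (g dg : R -> 'rV[R]_k) (a b M : R) :
  a <= b -> (forall s, a <= s <= b -> is_derive s 1 g (dg s)) ->
  (forall s, a <= s <= b -> `|dg s| <= M) ->
  `|g b - g a| <= M * (b - a).
Proof.
move=> ab gd dgM.
have M0 : 0 <= M by rewrite (le_trans _ (dgM a _))// lexx.
apply: rV_norm_le => [|j]; first by rewrite mulr_ge0// subr_ge0.
have gj s : a <= s <= b -> is_derive s 1 (fun s => g s ord0 j) (dg s ord0 j).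
  by move=> /gd; exact: is_derive_coord.
have [||s sI] := @MVT_segment _ (fun s => g s ord0 j) (fun s => dg s ord0 j) a b ab.
- by move=> s sI; apply: gj; rewrite !ltW// (itvP sI).
- by apply: derivable_within_continuous => s sI; case: (gj s) => //.
- rewrite !mxE => ->; rewrite normrM (@ger0_norm _ (b - a)) ?subr_ge0//.
  rewrite ler_wpM2r ?subr_ge0// (le_trans (rV_coord_le _ _))//.
  by apply: dgM; rewrite !(itvP sI).
Qed.

(** What the estimates retain of smoothness. Asking it on a neighbourhood makes the condition open;
    the first derivatives are then continuous. *)
Definition C2_at (V W : normedModType R) (f : V -> W) (p : V) :=
  \forall z \near p, differentiable f z /\
    forall v, differentiable (fun z => 'D_v f z) z.

Lemma smooth_at_C2 (V W : normedModType R) (f : V -> W) (p : V) :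
  smooth_at f p -> C2_at f p.
Proof.
move=> [U [oU Up sf]]; have : nbhs p U by exact: open_nbhs_nbhs.
apply: filterS => z Uz; have [dC DC] := sf 2%N.
split; [exact: dC | move=> v].
by have [+ _] := DC v; apply.
Qed.

Lemma C2_at_near (V W : normedModType R) (f : V -> W) (p : V) :
  C2_at f p -> \forall z \near p, C2_at f z.
Proof. exact: near_join. Qed.

Lemma Ck_on_cst (V W : normedModType R) n (w : W) :
  Ck_on n setT (cst w : V -> W).
Proof.
elim: n w => [|n IH] w /=; first by move=> x _; exact: cvg_cst.
split=> [x _|v]; first exact: differentiable_cst.
have -> : (fun x => 'D_v (cst w : V -> W) x) = cst 0.
  by apply/funext => x; rewrite derive_cst.
exact: IH.
Qed.

Lemma smooth_at_id (V : normedModType R) (x : V) : smooth_at (@id V) x.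
Proof.
exists setT; split=> //; first exact: openT.
case=> [|n] /=; first by move=> y _; exact: cvg_id.
split=> [y _|v]; first exact: ex_diff.
have -> : (fun x => 'D_v (@id V) x) = cst v.
  by apply/funext => y; rewrite derive_id.
exact: Ck_on_cst.
Qed.

Lemma schwarz_rV (V : normedModType R) k (f : V -> 'rV[R]_k) (p u v : V) :
  C2_at f p ->
  'D_v (fun z => 'D_u f z) p = 'D_u (fun z => 'D_v f z) p.
Proof.
move=> C2.
have df w : differentiable (fun z => 'D_w f z) p.
  by have [_] := nbhs_singleton C2.
have dj w j z : differentiable f z ->
    is_derive z w (fun y => f y ord0 j) ('D_w f z ord0 j).
  by move=> fz; exact/is_derive_coord/derivableP/diff_derivable.
have Ej w j : \forall z \near p,
    'D_w f z ord0 j = 'D_w (fun y => f y ord0 j) z.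
  by apply: filterS C2 => z [/(dj w j)[_ ->]].
have dDj w j : differentiable (fun z => 'D_w (fun y => f y ord0 j) z) p.
  by have [] := is_diff_near_eq (Ej w j) (differentiable_comp (df w)
    (differentiable_coord _ ord0 j)).
have coordE w1 w2 j : ('D_w2 (fun z => 'D_w1 f z) p) ord0 j =
    'D_w2 (fun z => 'D_w1 (fun y => f y ord0 j) z) p.
  have D := is_derive_coord j (derivableP (diff_derivable (v:=w2) (df w1))).
  by have [_ <-] := near_eq_is_derive (Ej w1 j) D.
apply/rowP => j; rewrite [LHS](coordE u v j) [RHS](coordE v u j).
apply: (schwarz _ _ (dDj u j) (dDj v j)).
- by apply: filterS C2 => z [/(dj u j)[]].
- by apply: filterS C2 => z [/(dj v j)[]].
Qed.

(** * Estimates on differentials, local inversion, derivatives in a subspace *)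

(** The differential varies continuously in each of the finitely many directions [e], hence
    uniformly on their span. With [e] free, the lemma serves on a space of rows and on either factor
    of a product of two such spaces. The n + 1 shares [eps] among n terms and is nonzero even for n
    = 0. *)
Lemma diff_near_le (V W : normedModType R) n (e : 'I_n -> V) (f : V -> W)
    (p : V) (eps : R) :
  C2_at f p -> 0 < eps ->
  \forall z \near p, forall w : 'rV[R]_n,
    `|'d f z (\sum_i w ord0 i *: e i) - 'd f p (\sum_i w ord0 i *: e i)|
      <= eps * `|w|.
Proof.
move=> C2 eps0.
have fp : differentiable f p by have [] := nbhs_singleton C2.
have en0 : 0 < eps / n.+1%:R by rewrite divr_gt0.
have ci : \forall z \near p, forall i,
    `|'D_(e i) f z - 'D_(e i) f p| <= eps / n.+1%:R.
  apply: filter_forall => i.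
  have [_ /(_ (e i)) /differentiable_continuous] := nbhs_singleton C2.
  move=> /cvgrPdist_le /(_ _ en0); apply: filterS => z.
  by rewrite distrC.
near=> z => w.
have fz : differentiable f z by have [] := near C2 z.
have dE z' : differentiable f z' ->
    'd f z' (\sum_i w ord0 i *: e i) = \sum_i w ord0 i *: 'D_(e i) f z'.
  move=> fz'; rewrite linear_sum; apply: eq_bigr => i _.
  by rewrite [LHS]linearZ deriveE.
rewrite (dE _ fz) (dE _ fp) -sumrB (le_trans (ler_norm_sum _ _ _))//.
apply: (@le_trans _ _ (\sum_(i < n) (eps / n.+1%:R * `|w|))).
  apply: ler_sum => i _; rewrite -scalerBr normrZ mulrC.
  by rewrite ler_pM// ?rV_coord_le// (near ci z).
rewrite sumr_const card_ord -[leLHS]mulr_natr [leLHS]mulrAC ler_wpM2r//.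
rewrite -mulrA ler_piMr ?(ltW eps0)// mulrC ler_pdivrMr// mul1r ler_nat.
exact: leqnSn.
Unshelve. all: by end_near. Qed.

(** Mean value inequality on the segment from y' to y, for [f] minus its linear part at [p]: the
    derivative is the variation of the differential, which is small near [p]. *)
Lemma strict_diff n k (f : 'rV[R]_n -> 'rV[R]_k) (p : 'rV[R]_n) (e : R) :
  C2_at f p -> 0 < e ->
  exists2 d : R, 0 < d & forall y y', `|y - p| < d -> `|y' - p| < d ->
    `|f y - f y' - 'd f p (y - y')| <= e * `|y - y'|.
Proof.
move=> C2 e0.
have fp : differentiable f p by have [] := nbhs_singleton C2.
have [d d0 H] := near_ex_ball (filterI C2
  (diff_near_le (fun i => delta_mx ord0 i : 'rV[R]_n) C2 e0)).
exists d => // y y' yd y'd.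
pose g (s : R) := f (y' + s *: (y - y')) - s *: 'd f p (y - y').
have near1 (s : R) : 0 <= s <= 1 -> `|y' + s *: (y - y') - p| < d.
  move=> /andP[s0 s1].
  have -> : y' + s *: (y - y') - p = (1 - s) *: (y' - p) + s *: (y - p).
    by apply/rowP => j; rewrite !mxE; ring.
  rewrite (le_lt_trans (ler_normD _ _))// !normrZ !ger0_norm ?subr_ge0//.
  have [->|s_neq0] := eqVneq s 0; first by rewrite subr0 mul1r mul0r addr0.
  have sp : 0 < s by rewrite lt_def s_neq0.
  have -> : d = (1 - s) * d + s * d by rewrite mulrBl subrK mul1r.
  by rewrite ler_ltD// ?ltr_pM2l// ler_wpM2l ?subr_ge0// ltW.
pose dg (s : R) := 'd f (y' + s *: (y - y')) (y - y') - 'd f p (y - y').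
have := @mean_value_le k g dg 0 1 (e * `|y - y'|) ler01.
have -> : g 0 = f y' by rewrite /g !scale0r addr0 subr0.
have -> : g 1 = f y - 'd f p (y - y') by rewrite /g !scale1r (addrC y') subrK.
rewrite subr0 mulr1 addrAC; apply.
- move=> s /near1/H[[fs _] _]; apply: is_deriveB.
    have := @is_derive_line _ _ f y' (y - y') s (diff_derivable fs).
    by rewrite (deriveE _ fs).
  exact: is_derive_scalel.
- move=> s /near1/H[_ Hs]; have := Hs (y - y'); rewrite -row_sum_delta; exact.
Qed.

Lemma lipschitz_ball_continuous (V W : normedModType R) (f : V -> W) (p : V)
    (d K : R) :
  (forall y y', `|y - p| < d -> `|y' - p| < d -> `|f y - f y'| <= K * `|y - y'|) ->
  forall y, `|y - p| < d -> {for y, continuous f}.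
Proof.
move=> Lip y yd; apply/cvgrPdist_le => e e0; near=> y'.
have y'd : `|y' - p| < d.
  have : `|y' - y| < d - `|y - p|.
    by near: y'; apply: nbhs_norm_lt; rewrite subr_gt0.
  by have := ler_normD (y' - y) (y - p); rewrite subrKA; lra.
have K0 : 0 < `|K| + 1 by rewrite ltr_wpDl.
have : `|y' - y| < e / (`|K| + 1).
  by near: y'; apply: nbhs_norm_lt; rewrite divr_gt0.
rewrite ltr_pdivlMr// distrC => yy'.
rewrite (le_trans (Lip _ _ yd y'd))// mulrC (le_trans _ (ltW yy'))//.
by rewrite ler_wpM2l// (le_trans (ler_norm _))// lerDl.
Unshelve. all: by end_near. Qed.

(** Surjectivity by minimisation: |Psi y - z| attains its minimum on a compact ball, and the step y
    - (Psi y - z) at least halves this distance, so the minimum is 0. The radius d / 4 keeps the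
    step in the ball of radius d / 2, since d / 4 + (d / 2) / 2 = d / 2. *)
Lemma local_inverse n (Psi : 'rV[R]_n -> 'rV[R]_n) (y0 : 'rV[R]_n) (d : R) :
  0 < d ->
  (forall y y', `|y - y0| < d -> `|y' - y0| < d ->
    `|Psi y - Psi y' - (y - y')| <= 2^-1 * `|y - y'|) ->
  forall z, `|z - Psi y0| < d / 4 -> exists2 y, `|y - y0| < d & Psi y = z.
Proof.
move=> d0 H z zd.
have d20 : 0 < d / 2 by rewrite divr_gt0.
have d2d : d / 2 < d by rewrite ltr_pdivrMr// ltr_pMr// ltr1n.
pose A := [set y : 'rV[R]_n | `|y - y0| <= d / 2].
have Ad y : A y -> `|y - y0| < d by move=> /le_lt_trans; apply.
have cA : compact A.
  have AE : A = closed_ball y0 (d / 2).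
    rewrite closed_ballE//; apply/seteqP; split=> y; rewrite /A /closed_ball_/=;
      by rewrite distrC.
  apply: bounded_closed_compact; last by rewrite AE; exact: closed_ball_closed.
  exists (d / 2 + `|y0|); split; first exact: num_real.
  move=> M dM y /= Ay; apply: ltW; apply: le_lt_trans dM.
  by rewrite -[y](subrK y0) (le_trans (ler_normD _ _))// lerD2r.
have A0 : A y0 by rewrite /A /= subrr normr0 ltW.
have Lip y y' : `|y - y0| < d -> `|y' - y0| < d ->
    `|Psi y - Psi y'| <= 2 * `|y - y'|.
  move=> yd y'd; have := H _ _ yd y'd.
  have := ler_normD (Psi y - Psi y' - (y - y')) (y - y').
  rewrite subrK; have := normr_ge0 (y - y'); lra.
have cq : {within A, continuous (fun y => `|Psi y - z|)}.
  apply: continuous_in_subspaceT => y; rewrite inE => /Ad yd.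
  apply: (lipschitz_ball_continuous (K := 2) _ yd) => y1 y2 y1d y2d.
  rewrite (le_trans (ler_dist_dist _ _))// opprB addrA subrK.
  exact: Lip.
have [y yA ymin] := EVT_min_rV (ex_intro _ y0 A0) cA cq.
rewrite inE in yA; pose y1 := y - (Psi y - z).
have y1A : A y1.
  have h1 := H _ _ (Ad _ yA) (Ad _ A0).
  rewrite /A /=; have -> : y1 - y0 = (z - Psi y0) - (Psi y - Psi y0 - (y - y0)).
    by apply/rowP => j; rewrite !mxE; ring.
  by rewrite (le_trans (ler_normB _ _))//; move: yA zd h1; lra.
exists y; first exact: Ad.
have := H _ _ (Ad _ y1A) (Ad _ yA).
have -> : y1 - y = z - Psi y by apply/rowP => j; rewrite !mxE; ring.
have -> : Psi y1 - Psi y - (z - Psi y) = Psi y1 - z.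
  by apply/rowP => j; rewrite !mxE; ring.
have := ymin y1; rewrite inE => /(_ y1A) /le_trans le1 /le1.
rewrite distrC => le2.
have : `|z - Psi y| <= 0 by have := normr_ge0 (z - Psi y); lra.
by rewrite normr_le0 subr_eq0 => /eqP.
Qed.

Lemma mulmx_norm_le k n (B : 'M[R]_(k, n)) :
  exists2 C : R, 0 < C & forall w : 'rV[R]_k, `|w *m B| <= C * `|w|.
Proof.
pose S := \sum_i \sum_j `|B i j|.
have S0 : 0 <= S by apply: sumr_ge0 => i _; apply: sumr_ge0.
exists (1 + S) => [|w]; first by rewrite ltr_wpDr.
apply: rV_norm_le => [|j]; first by rewrite mulr_ge0// addr_ge0.
rewrite mxE (le_trans (ler_norm_sum _ _ _))//.
apply: (@le_trans _ _ (\sum_i `|w| * \sum_j `|B i j|)).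
  apply: ler_sum => i _; rewrite normrM ler_pM ?rV_coord_le//.
  by rewrite (bigD1 j)//= lerDl sumr_ge0.
by rewrite -mulr_sumr mulrC ler_wpM2r// lerDr.
Qed.

Lemma is_diff_mulmxr (V : normedModType R) m k (M : 'M[R]_(m, k))
    (f : V -> 'rV[R]_m) (z : V) :
  differentiable f z ->
  is_diff z (fun y => f y *m M) (fun w => 'd f z w *m M).
Proof.
move=> df; have cM : continuous (mulmxr M : 'rV[R]_m -> 'rV[R]_k).
  have [C C0 CP] := mulmx_norm_le M.
  move=> x; apply: (@lipschitz_ball_continuous _ _ (mulmxr M) x 1 C).
    by move=> y y' _ _; rewrite /= -mulmxBl.
  by rewrite subrr normr0.
have dM := @linear_differentiable _ _ _ (mulmxr M) (f z) cM.
have := @is_diff_comp _ _ _ _ f _ (mulmxr M) _ z (differentiableP df)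
  (differentiableP dM).
have dE : 'd (mulmxr M) (f z) = mulmxr M :> ('rV[R]_m -> 'rV[R]_k).
  exact: diff_lin.
by rewrite dE.
Qed.

(** The complementary projection [M] kills z, so f s *m M = (f s - z) *m M is negligible before |z|,
    hence before |f s|, which is O(|s|). Thus w *m M = 0, however z depends on s. *)
Lemma derive_in_subspace n (l : {vspace 'rV[R]_n}) (f : R -> 'rV[R]_n) w :
  is_derive (0 : R) 1 f w -> f 0 = 0 ->
  (forall e : R, 0 < e -> \forall s \near (0 : R),
     exists2 z, z \in l & `|f s - z| <= e * `|z|) ->
  w \in l.
Proof.
move=> fw f0 H.
pose M := 1%:M - lin1_mx (projv l).
have ME z : z *m M = z - projv l z.
  by rewrite mulmxBr mulmx1 mul_rV_lin1.
have Ml z : z \in l -> z *m M = 0 by move=> zl; rewrite ME projv_id// subrr.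
suff : w *m M = 0.
  by rewrite ME => /subr0_eq ->; exact: memv_proj.
have [C C0 CP] := mulmx_norm_le M.
have df : differentiable f 0 by apply/derivable1_diffP; case: fw.
have fM : is_derive (0 : R) 1 (fun s => f s *m M) (w *m M).
  have [dfM dfE] := is_diff_mulmxr M df.
  split; first exact/derivable1_diffP.
  by rewrite deriveE// dfE -deriveE//; case: fw => _ ->.
apply: is_derive_uniq fM _; apply: is_derive_le => e e0.
have K0 : 0 < `|w| + 1 by rewrite ltr_wpDl.
have [d1 d10 fle] := near_ex_ball (differentiable_near_le df ltr01).
have dfs (s : R) : 'd f 0 s = s *: w.
  have /(congr1 (fun h => h s)) := diff1E df; rewrite derive1E.
  by case: fw => _ -> ->.
have fle' (s : R) : `|s| < d1 -> `|f s| <= (`|w| + 1) * `|s|.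
  move=> sd; have := fle s; rewrite subr0 f0 subr0 mul1r dfs => /(_ sd) h.
  rewrite -[f s](subrK (s *: w)) (le_trans (ler_normD _ _))// normrZ.
  by rewrite mulrDl mul1r addrC (mulrC `|w|) lerD2l.
(* The bound 1/2 gives |z| <= 2 |f s|. In the other bound the factors 2, [C] and |w| + 1 absorb this
   estimate, the norm of [M] and the growth |f s| <= (|w| + 1) |s|. *)
have e10 : 0 < Num.min 2^-1 (e / (2 * C * (`|w| + 1))).
  by rewrite lt_min invr_gt0 ltr0n divr_gt0// !mulr_gt0.
have [d2 d20 d2P] := near_ex_ball (H _ e10).
exists (Num.min d1 d2); first by rewrite lt_min d10.
move=> s; rewrite f0 mul0mx scaler0 !subr0 lt_min => /andP[s1 s2].
have [|z zl fz] := d2P s; first by rewrite subr0.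
have fz1 : `|f s - z| <= 2^-1 * `|z|.
  by rewrite (le_trans fz)// ler_wpM2r// ge_min lexx.
have fz2 : `|f s - z| <= e / (2 * C * (`|w| + 1)) * `|z|.
  by rewrite (le_trans fz)// ler_wpM2r// ge_min lexx orbT.
have zle : `|z| <= 2 * `|f s|.
  have := ler_normB (f s) (f s - z).
  by rewrite opprB addrC subrK; lra.
have -> : f s *m M = (f s - z) *m M by rewrite mulmxBl (Ml z zl) subr0.
rewrite (le_trans (CP _))// -ler_pdivlMl// (le_trans fz2)//.
have q0 : 0 <= e / (2 * C * (`|w| + 1)).
  by rewrite divr_ge0 ?(ltW e0)// !mulr_ge0 ?(ltW C0) ?(ltW K0).
have zs := le_trans zle (ler_wpM2l (ler0n R 2) (fle' _ s1)).
rewrite (le_trans (ler_wpM2l q0 zs))// le_eqVlt; apply/orP; left; apply/eqP.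
by field; rewrite !gt_eqF.
Qed.

(** * Level sets of maps of constant rank *)

(** The map y - (y - y0) A B + (F y - F y0) B has the identity as differential at [y0], so it can be
    inverted along the line y0 + s v. Multiplying the resulting equation by A B, with B A B = B and
    v A = 0, cancels all but (F y - F y0) B. Only this part of F y = F y0 is solved; it is the whole
    equation when B A = 1. *)
Lemma level_curve n k (F : 'rV[R]_n -> 'rV[R]_k) (y0 v : 'rV[R]_n)
    (A : 'M[R]_(n, k)) (B : 'M[R]_(k, n)) :
  C2_at F y0 -> (forall w, 'd F y0 w = w *m A) ->
  B *m A *m B = B -> v *m A = 0 ->
  exists (c : R -> 'rV[R]_n) (d K : R),
    [/\ 0 < d, c 0 = y0, is_derive (0 : R) 1 c v,
        (forall s t : R, `|s| < d -> `|t| < d -> `|c s - c t| <= K * `|s - t|) &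
        (forall s : R, `|s| < d -> (F (c s) - F y0) *m B = 0)].
Proof.
move=> C2 dF BAB vA.
have [C C0 BC] := mulmx_norm_le B.
have strict (e : R) : 0 < e -> exists2 d : R, 0 < d & forall y y',
    `|y - y0| < d -> `|y' - y0| < d ->
    `|(F y - F y' - (y - y') *m A) *m B| <= e * `|y - y'|.
  move=> e0; have eC0 : 0 < e / C by rewrite divr_gt0.
  have [d d0 H] := strict_diff C2 eC0; exists d => // y y' yd y'd.
  rewrite (le_trans (BC _))// -dF mulrC -ler_pdivlMr// mulrAC.
  exact: H.
pose Psi y := y - (y - y0) *m A *m B + (F y - F y0) *m B.
have PsiB y y' : Psi y - Psi y' - (y - y') =
    (F y - F y' - (y - y') *m A) *m B.
  rewrite /Psi !mulmxBl.
  move: (y *m A *m B) (y' *m A *m B) (y0 *m A *m B) (F y *m B) (F y' *m B).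
  move: (F y0 *m B) => x1 x2 x3 x4 x5 x6.
  by apply/rowP => j; rewrite !mxE; ring.
have Psi0 : Psi y0 = y0 by rewrite /Psi !subrr !mul0mx subr0 addr0.
have half0 : 0 < (2^-1 : R) by rewrite invr_gt0.
have [d d0 dP] := strict _ half0.
have dPsi y y' : `|y - y0| < d -> `|y' - y0| < d ->
    `|Psi y - Psi y' - (y - y')| <= 2^-1 * `|y - y'|.
  by rewrite PsiB; exact: dP.
have Psi_lip y y' : `|y - y0| < d -> `|y' - y0| < d ->
    `|y - y'| <= 2 * `|Psi y - Psi y'|.
  move=> yd y'd; have := dPsi _ _ yd y'd.
  have := ler_normB (Psi y - Psi y') (Psi y - Psi y' - (y - y')).
  by rewrite opprB addrC subrK; lra.
(* [d / 4] is the radius on which [Psi] is inverted, and |v| + 1 a positive bound for the speed of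
   the line. Beyond [r] the curve takes the default value [y0]. *)
pose r := d / 4 / (`|v| + 1).
have v10 : 0 < `|v| + 1 by rewrite ltr_wpDl.
have r0 : 0 < r by rewrite !divr_gt0.
have /choice [c cP] : forall s : R, exists y, `|s| < r ->
    `|y - y0| < d /\ Psi y = y0 + s *: v.
  move=> s; have [sr|_] := ltP `|s| r; last by exists y0.
  have [|y yd yP] := local_inverse d0 dPsi (z := y0 + s *: v).
    rewrite Psi0 addrAC subrr add0r normrZ.
    apply: (@le_lt_trans _ _ (`|s| * (`|v| + 1))).
      by rewrite ler_wpM2l// lerDl.
    by rewrite -ltr_pdivlMr.
  by exists y => _.
have cd s : `|s| < r -> `|c s - y0| < d by move=> /cP[].
have cPsi s : `|s| < r -> Psi (c s) = y0 + s *: v by move=> /cP[].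
have r00 : `|0 : R| < r by rewrite normr0.
have c0 : c 0 = y0.
  have y0d : `|y0 - y0| < d by rewrite subrr normr0.
  have := Psi_lip _ _ (cd _ r00) y0d.
  rewrite Psi0 cPsi// scale0r addr0 subrr normr0 mulr0 normr_le0 subr_eq0.
  by move/eqP.
have c_lip s t : `|s| < r -> `|t| < r -> `|c s - c t| <= 2 * `|v| * `|s - t|.
  move=> sr tr; rewrite (le_trans (Psi_lip _ _ (cd _ sr) (cd _ tr)))//.
  rewrite !cPsi// -mulrA ler_wpM2l// opprD addrACA subrr add0r -scalerBl.
  by rewrite normrZ mulrC.
exists c, r, (2 * `|v|); split=> //.
- apply: is_derive_le => e e0.
  have e20 : 0 < e / (2 * (`|v| + 1)) by rewrite divr_gt0// mulr_gt0.
  have [d' d'0 d'P] := strict _ e20.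
  exists (Num.min r (d' / (2 * (`|v| + 1)))).
    by rewrite lt_min r0 divr_gt0// mulr_gt0.
  move=> s; rewrite subr0 lt_min => /andP[sr sd'].
  have vv : 2 * `|v| <= 2 * (`|v| + 1) by rewrite ler_wpM2l// lerDl.
  have csd' : `|c s - y0| < d'.
    rewrite -[X in `|_ - X|]c0 (le_lt_trans (c_lip _ _ sr r00))//.
    rewrite ltr_pdivlMr ?mulr_gt0// in sd'; apply: le_lt_trans sd'.
    by rewrite subr0 mulrC ler_wpM2l.
  have y0d' : `|y0 - y0| < d' by rewrite subrr normr0.
  (* As Psi (c s) = y0 + s v, the defect of [c] from its tangent line is that of [Psi] from the
     identity, o(|c s - y0|) = o(|s|). *)
  have -> : c s - c 0 - s *: v = - (Psi (c s) - Psi y0 - (c s - y0)).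
    by rewrite Psi0 cPsi// c0 (addrAC y0) subrr add0r opprB.
  rewrite normrN PsiB (le_trans (d'P _ _ csd' y0d'))//.
  rewrite -[X in `|_ - X|]c0 (le_trans (ler_wpM2l (ltW e20) (c_lip _ _ sr r00)))//.
  rewrite subr0.
  rewrite mulrA ler_wpM2r// -mulrA ler_piMr ?(ltW e0)//.
  by rewrite mulrC ler_pdivrMr ?mulr_gt0// mul1r.
- move=> s sr; have := cPsi _ sr; rewrite /Psi; move: (c s) => y yE.
  have {yE} : (y - y0) - (y - y0) *m A *m B + (F y - F y0) *m B = s *: v.
    rewrite -[RHS](addKr y0) -yE; move: (_ *m B) (_ *m B) => x1 x2.
    by apply/rowP => j; rewrite !mxE; ring.
  move=> /(congr1 (fun w => w *m A *m B)).
  rewrite -scalemxAl vA scaler0 mul0mx mulmxDl mulmxBl mulmxDl mulmxBl.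
  by rewrite -!mulmxA !(mulmxA B) BAB subrr add0r.
Qed.

Lemma diff_add (V W : normedModType R) (f : V -> W) (x a b : V) :
  'd f x (a + b) = 'd f x a + 'd f x b.
Proof. exact: linearD. Qed.

Lemma diff_near_mx_le n k (F : 'rV[R]_n -> 'rV[R]_k) (p : 'rV[R]_n)
    (A : 'M[R]_(n, k)) (eps : R) :
  C2_at F p -> (forall w, 'd F p w = w *m A) -> 0 < eps ->
  \forall z \near p, forall w, `|'d F z w - w *m A| <= eps * `|w|.
Proof.
move=> C2 dF eps0.
apply: filterS (diff_near_le (fun i => delta_mx ord0 i : 'rV[R]_n) C2 eps0).
by move=> z Hz w; have := Hz w; rewrite -row_sum_delta -(dF w).
Qed.

(** A vector z of the kernel satisfies |z| <= |z| / 2. *)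
Lemma small_perturbation_unit n (H : 'M[R]_n) :
  (forall z : 'rV[R]_n, `|z *m H - z| <= 2^-1 * `|z|) -> H \in unitmx.
Proof.
move=> Hz; rewrite -row_free_unit -kermx_eq0; apply/eqP/row_matrixP => i.
rewrite row0; set z := row i _.
have zH : z *m H = 0 by apply: sub_kermxP; exact: row_sub.
have := Hz z; rewrite zH sub0r normrN => z2.
have : `|z| <= 0 by have := normr_ge0 z; lra.
by rewrite normr_le0 => /eqP.
Qed.

(* The rank of [dF] may increase away from [y0].  The maps [T] forbid it on the
   set [(F y - F y0) *m B = 0], hence [dF] is controlled by [dF *m B] there, and
   [F] is constant along the curve of [level_curve]. *)
Lemma constant_rank_curve n k (F : 'rV[R]_n -> 'rV[R]_k) (y0 v : 'rV[R]_n)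
    (A : 'M[R]_(n, k)) (B : 'M[R]_(k, n)) :
  C2_at F y0 -> (forall w, 'd F y0 w = w *m A) ->
  A *m B *m A = A -> B *m A *m B = B -> v *m A = 0 ->
  (forall e : R, 0 < e -> \forall y \near y0, (F y - F y0) *m B = 0 ->
    exists T : 'M[R]_n, forall xi, xi *m A = 0 ->
      'd F y (xi *m T) = 0 /\ `|xi *m T - xi| <= e * `|xi|) ->
  exists (c : R -> 'rV[R]_n) (d : R),
    [/\ 0 < d, c 0 = y0, is_derive (0 : R) 1 c v &
        (forall s : R, `|s| < d -> F (c s) = F y0)].
Proof.
move=> C2 dF ABA BAB vA HT.
have [c [d [K [d0 c0 cv cK cB]]]] := level_curve C2 dF BAB vA.
have [CA CA0 CAP] := mulmx_norm_le A.
have [CB CB0 CBP] := mulmx_norm_le B.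
have [CP CP0 CPP] := mulmx_norm_le (1%:M - A *m B).
have e10 : 0 < 2^-1 / CP by rewrite divr_gt0 ?invr_gt0.
have e20 : 0 < 2^-1 / CB by rewrite divr_gt0 ?invr_gt0.
have [r r0 rP] := near_ex_ball (filterI C2 (filterI (HT _ e10)
  (filterI (diff_near_mx_le C2 dF e20) (diff_near_mx_le C2 dF ltr01)))).
(* [T] sends ker A into the kernel of ['d F y] and is near the identity there, so [H] is invertible:
   every xi is a vector of that kernel plus some z2 with z2 A B = z2, and on z2 the map ['d F y]
   followed by [B] is near the identity. The constants 2^-1 / CP and 2^-1 / CB make each of these
   two errors at most half of the norm. *)
have bound y xi : `|y - y0| < r -> (F y - F y0) *m B = 0 ->
    `|'d F y xi| <= (CA + 1) * 2 * `|'d F y xi *m B|.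
  move=> /rP[[Fy _] [exT [dB d1]]] /exT[T TP].
  pose H := (1%:M - A *m B) *m T + A *m B.
  have ker (z : 'rV[R]_n) : z *m (1%:M - A *m B) *m A = 0.
    by rewrite -mulmxA mulmxBl mul1mx ABA subrr mulmx0.
  have uH : H \in unitmx.
    apply: small_perturbation_unit => z.
    have -> : z *m H - z = z *m (1%:M - A *m B) *m T - z *m (1%:M - A *m B).
      rewrite /H mulmxDr -addrA; congr (_ + _); first by rewrite mulmxA.
      by rewrite mulmxBr mulmx1 opprB.
    have [_ h] := TP _ (ker z); rewrite (le_trans h)//.
    by rewrite -mulrA ler_wpM2l ?invr_ge0// mulrC ler_pdivrMr// mulrC.
  pose z := xi *m invmx H; pose z2 := z *m (A *m B).
  have xiE : xi = z *m (1%:M - A *m B) *m T + z2.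
    by rewrite -[LHS](mulmxKV uH) -/z /H mulmxDr mulmxA.
  have z2AB : z2 *m A *m B = z2.
    by rewrite /z2 -(mulmxA (z *m _)) -(mulmxA z) (mulmxA _ A) ABA.
  have [TP0 _] := TP _ (ker z).
  clearbody z2 z.
  have dxi : 'd F y xi = 'd F y z2.
    rewrite xiE; have := diff_add F y (z *m (1%:M - A *m B) *m T) z2.
    by rewrite TP0 add0r.
  have z2le : `|z2| <= 2 * `|'d F y xi *m B|.
    have h := dB z2.
    have h' := CBP ('d F y z2 - z2 *m A); rewrite mulmxBl z2AB in h'.
    have : `|'d F y z2 *m B - z2| <= 2^-1 * `|z2|.
      rewrite (le_trans h')// -ler_pdivlMl// mulrA (mulrC CB^-1).
      exact: h.
    have := ler_normB ('d F y z2 *m B) ('d F y z2 *m B - z2).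
    by rewrite dxi opprB addrC subrK; lra.
  have h := d1 z2; rewrite -dxi mul1r in h.
  have := ler_normD ('d F y xi - z2 *m A) (z2 *m A); rewrite subrK => h1.
  have CA1 : 0 <= CA + 1 by rewrite addr_ge0// ltW.
  have h2 := ler_wpM2l CA1 z2le; rewrite -mulrA (le_trans _ h2)//.
  have h3 := CAP z2; rewrite mulrDl mul1r; lra.
pose K' : R := `|K| + 1.
have K'0 : 0 < K' by rewrite ltr_wpDl.
have cK' (s t : R) : `|s| < d -> `|t| < d -> `|c s - c t| <= K' * `|s - t|.
  move=> sd td; rewrite (le_trans (cK _ _ sd td))// ler_wpM2r//.
  by rewrite (le_trans (ler_norm _))// lerDl.
pose dl := Num.min d (r / K').
have dl0 : 0 < dl by rewrite lt_min d0 divr_gt0.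
have cr (s : R) : `|s| < dl -> `|c s - y0| < r.
  rewrite lt_min => /andP[sd sr]; rewrite -c0.
  rewrite (le_lt_trans (cK' _ _ sd _)) ?normr0// subr0.
  by rewrite mulrC -ltr_pdivlMr.
have dFc (s : R) : `|s| < dl -> is_derive s 1 (F \o c) 0.
  move=> sdl; have sd : `|s| < d by move: sdl; rewrite lt_min => /andP[].
  have Fs : differentiable F (c s) by have [[]] := rP _ (cr _ sdl).
  pose M := 1 + (CA + 1) * 2 * CB.
  have M0 : 0 < M by rewrite ltr_wpDr// !mulr_ge0 ?addr_ge0 ?ltW.
  apply: is_derive_le => e e0.
  have eM0 : 0 < e / (M * K') by rewrite divr_gt0// mulr_gt0.
  have [r1 r10 r1P] := near_ex_ball (differentiable_near_le Fs eM0).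
  exists (Num.min (d - `|s|) (r1 / K')).
    by rewrite lt_min subr_gt0 sd divr_gt0.
  move=> t; rewrite lt_min => /andP[t1 t2].
  have td : `|t| < d by have := ler_normD (t - s) s; rewrite subrK; lra.
  have ct := cK' _ _ td sd.
  have ctr : `|c t - c s| < r1.
    by rewrite (le_lt_trans ct)// mulrC -ltr_pdivlMr.
  have := r1P _ ctr; rewrite scaler0 subr0 /=; set xi := c t - c s => h.
  have FB : (F (c t) - F (c s)) *m B = 0.
    move: (cB _ td) (cB _ sd); rewrite !mulmxBl => /subr0_eq -> /subr0_eq ->.
    by rewrite subrr.
  have := CBP (F (c t) - F (c s) - 'd F (c s) xi).
  rewrite mulmxBl FB sub0r normrN => h1.
  have h2 := bound _ xi (cr _ sdl) (cB _ sd).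
  have h3 := ler_normD (F (c t) - F (c s) - 'd F (c s) xi) ('d F (c s) xi).
  rewrite subrK in h3.
  have {}h1 := le_trans h1 (ler_wpM2l (ltW CB0) h).
  have CA20 : 0 <= (CA + 1) * 2 by rewrite mulr_ge0// addr_ge0// ltW.
  have {}h2 := le_trans h2 (ler_wpM2l CA20 h1).
  rewrite (le_trans h3)// (le_trans (lerD h h2))//.
  have -> : e / (M * K') * `|xi| + (CA + 1) * 2 * (CB * (e / (M * K') * `|xi|)) =
      M * (e / (M * K')) * `|xi| by rewrite /M; ring.
  have -> : M * (e / (M * K')) = e / K'.
    by field; rewrite !gt_eqF.
  by rewrite -mulrA ler_wpM2l ?(ltW e0)// ler_pdivrMl.
exists c, dl; split=> // s sdl.
have cst (a b : R) : a <= b -> (forall t, a <= t <= b -> `|t| < dl) ->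
    F (c b) = F (c a).
  move=> ab abl; apply/eqP; rewrite -subr_eq0 -normr_le0.
  rewrite -[leRHS](mul0r (b - a)).
  apply: (mean_value_le (g := F \o c) (dg := fun=> 0) ab) => [t /abl/dFc//|t _].
  by rewrite normr0.
rewrite -[in RHS]c0; have [s0|s0] := leP 0 s.
- apply: cst => // t /andP[t0 ts].
  by move: sdl; rewrite !ger0_norm//; exact: le_lt_trans.
- apply/esym/cst => [|t /andP[st t0]]; first exact: ltW.
  move: sdl; rewrite !ler0_norm ?(ltW s0)//.
  by apply: le_lt_trans; rewrite lerN2.
Qed.

(** * Level sets of a pair of maps *)

Lemma right_inverse_mx n k (A : 'M[R]_(n, k)) :
  (forall w : 'rV[R]_k, exists u : 'rV[R]_n, u *m A = w) ->
  exists B : 'M[R]_(k, n), B *m A = 1%:M.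
Proof.
move=> H; have /choice[u uP] : forall i : 'I_k, exists u : 'rV[R]_n,
  u *m A = delta_mx ord0 i by move=> i; exact: H.
exists (\matrix_i u i); apply/row_matrixP => i.
by rewrite row_mul rowK uP row1.
Qed.

(** The last clause places the set (F y - F y0) B = 0 in a fibre of the first map; for the target
    map this is where right translation provides the maps [T]. [P] projects onto ker At, and [A2] is
    [As] read there. As [pinvmx] gives only A2 Q A2 = A2, [B2] uses Q A2 Q to obtain B2 A2 B2 = B2
    too, and ends with [P] so that B2 At = 0; multiplying (t, s) B by [At] then leaves t. *)
Lemma adapted_pseudo_inverse n m k (At : 'M[R]_(n, m)) (As : 'M[R]_(n, k))
    (B1 : 'M[R]_(m, n)) :
  B1 *m At = 1%:M ->
  exists B : 'M[R]_(m + k, n),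
    [/\ row_mx At As *m B *m row_mx At As = row_mx At As,
        B *m row_mx At As *m B = B &
        forall (t : 'rV[R]_m) (s : 'rV[R]_k), row_mx t s *m B = 0 -> t = 0].
Proof.
move=> B1At.
pose P := 1%:M - At *m B1; pose A2 := P *m As.
pose Q := pinvmx A2; pose B2 := Q *m A2 *m Q *m P.
have PAt : P *m At = 0 by rewrite mulmxBl mul1mx -mulmxA B1At mulmx1 subrr.
have B1P : B1 *m P = 0 by rewrite mulmxBr mulmx1 mulmxA B1At mul1mx subrr.
have PP : P *m P = P by rewrite {2}/P mulmxBr mulmx1 mulmxA PAt mul0mx subr0.
have PA2 : P *m A2 = A2 by rewrite mulmxA PP.
have A2Q : A2 *m Q *m A2 = A2 by rewrite mulmxKpV.
have B2A2 : B2 *m A2 = Q *m A2.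
  by rewrite /B2 -(mulmxA _ P) PA2 -2!(mulmxA Q) A2Q.
have B2P : B2 *m P = B2 by rewrite -mulmxA PP.
have B2As : B2 *m As = B2 *m A2 by rewrite -{1}B2P mulmxA.
have B2At : B2 *m At = 0 by rewrite -mulmxA PAt mulmx0.
have A2B2A2 : A2 *m B2 *m A2 = A2 by rewrite -mulmxA B2A2 mulmxA A2Q.
have B2A2B2 : B2 *m A2 *m B2 = B2.
  have SS : Q *m A2 *m (Q *m A2) = Q *m A2 by rewrite mulmxA -2!(mulmxA Q) A2Q.
  by rewrite B2A2 /B2 2!mulmxA SS.
have A2E : A2 = As - At *m B1 *m As by rewrite /A2 /P mulmxBl mul1mx.
have B1A2 : B1 *m A2 = 0 by rewrite mulmxA B1P mul0mx.
clearbody B2 Q A2 P.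
exists (col_mx (B1 - B1 *m As *m B2) B2).
rewrite !mul_row_col.
have AB : At *m (B1 - B1 *m As *m B2) + As *m B2 = At *m B1 + A2 *m B2.
  rewrite [in RHS]A2E mulmxBl mulmxBr !mulmxA -!addrA; congr (_ + _).
  by rewrite addrC.
rewrite AB; split.
- rewrite mul_mx_row; congr row_mx.
    by rewrite mulmxDl -!mulmxA B1At mulmx1 B2At mulmx0 addr0.
  rewrite mulmxDl -[A2 *m _ *m _]mulmxA B2As mulmxA A2B2A2 A2E.
  by rewrite addrC subrK.
- rewrite -mulmxA mul_row_col AB mul_col_mx; congr col_mx.
    rewrite mulmxDr mulmxBl [B1 *m (_ *m _)]mulmxA B1At mul1mx.
    have -> : B1 *m As *m B2 *m (At *m B1) = 0.
      by rewrite mulmxA -(mulmxA _ B2) B2At mulmx0 mul0mx.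
    rewrite subr0 mulmxBl [B1 *m (_ *m _)]mulmxA B1A2 mul0mx sub0r.
    by rewrite -(mulmxA _ B2) (mulmxA B2) B2A2B2.
  rewrite mulmxDr [B2 *m (At *m _)]mulmxA B2At mul0mx add0r mulmxA.
  exact: B2A2B2.
- move=> t s; rewrite mul_row_col => h.
  have := congr1 (mulmx^~ At) h.
  rewrite mul0mx mulmxDl -(mulmxA s) B2At mulmx0 addr0 -(mulmxA t).
  by rewrite mulmxBl B1At -(mulmxA _ B2) B2At mulmx0 subr0 mulmx1.
Qed.

Lemma diff_mxE n k (F : 'rV[R]_n -> 'rV[R]_k) (y w : 'rV[R]_n) :
  'd F y w = w *m lin1_mx ('d F y).
Proof. by rewrite mul_rV_lin1. Qed.

Lemma C2_at_row_mx (V : normedModType R) m k (f : V -> 'rV[R]_m)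
    (g : V -> 'rV[R]_k) (p : V) :
  C2_at f p -> C2_at g p ->
  C2_at (fun y => row_mx (f y) (g y)) p /\
  forall w, 'd (fun y => row_mx (f y) (g y)) p w = row_mx ('d f p w) ('d g p w).
Proof.
move=> C2f C2g.
have E (a : 'rV[R]_m) (b : 'rV[R]_k) :
    a *m row_mx 1%:M 0 + b *m row_mx 0 1%:M = row_mx a b.
  by rewrite !mul_mx_row !mulmx1 !mulmx0 add_row_mx addr0 add0r.
have D (F : V -> 'rV[R]_m) (H : V -> 'rV[R]_k) z :
    differentiable F z -> differentiable H z ->
    is_diff z (fun y => row_mx (F y) (H y)) (fun w => row_mx ('d F z w) ('d H z w)).
  move=> dF dH; have := is_diffD (is_diff_mulmxr (row_mx 1%:M 0) dF)
    (is_diff_mulmxr (row_mx 0 1%:M) dH).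
  rewrite (_ : _ + _ = (fun y => row_mx (F y) (H y))); last first.
    by apply/funext => y; rewrite fctE E.
  rewrite (_ : _ + _ = (fun w => row_mx ('d F z w) ('d H z w)))//.
  by apply/funext => y; rewrite fctE E.
have near12 : \forall z \near p,
    (differentiable f z /\ forall v, differentiable (fun z => 'D_v f z) z) /\
    (differentiable g z /\ forall v, differentiable (fun z => 'D_v g z) z).
  exact: filterI.
split; last first.
  have [[df _] [dg _]] := nbhs_singleton near12 => w.
  by have [_ ->] := D _ _ _ df dg.
have Ev : \forall z \near p, forall v, row_mx ('D_v f z) ('D_v g z) =
    'D_v (fun y => row_mx (f y) (g y)) z.
  apply: filterS near12 => z [[df _] [dg _]] v.
  have [d dE] := D _ _ _ df dg; rewrite [RHS](deriveE _ d) dE.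
  by rewrite (deriveE _ df) (deriveE _ dg).
apply: filterS (filterI near12 (near_join Ev)) => z [[[df ddf] [dg ddg]] Ez].
split; first by have [] := D _ _ _ df dg.
move=> v; have Ezv : \forall z \near z, row_mx ('D_v f z) ('D_v g z) =
    'D_v (fun y => row_mx (f y) (g y)) z by apply: filterS Ez => y; exact.
have [dr _] := D _ _ _ (ddf v) (ddg v).
by have [] := is_diff_near_eq Ezv dr.
Qed.

(** The maps [T] are supplied only on the fibre of [Ft]; the pseudo-inverse adapted to [B1] ensures
    that [constant_rank_curve] asks for them only there. *)
Lemma constant_rank_curve_pair n m k (Ft : 'rV[R]_n -> 'rV[R]_m)
    (Fs : 'rV[R]_n -> 'rV[R]_k) (y0 v : 'rV[R]_n) (B1 : 'M[R]_(m, n)) :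
  C2_at Ft y0 -> C2_at Fs y0 -> B1 *m lin1_mx ('d Ft y0) = 1%:M ->
  'd Ft y0 v = 0 -> 'd Fs y0 v = 0 ->
  (forall e : R, 0 < e -> \forall y \near y0, Ft y = Ft y0 ->
    exists T : 'M[R]_n, forall xi, 'd Ft y0 xi = 0 -> 'd Fs y0 xi = 0 ->
      [/\ 'd Ft y (xi *m T) = 0, 'd Fs y (xi *m T) = 0 &
          `|xi *m T - xi| <= e * `|xi|]) ->
  exists (c : R -> 'rV[R]_n) (d : R),
    [/\ 0 < d, c 0 = y0, is_derive (0 : R) 1 c v &
        (forall s : R, `|s| < d -> Ft (c s) = Ft y0 /\ Fs (c s) = Fs y0)].
Proof.
move=> Ct Cs BAt tv sv HT.
have [B [ABA BAB Bt]] := adapted_pseudo_inverse (lin1_mx ('d Fs y0)) BAt.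
set A := row_mx _ _ in ABA BAB.
have [CF dF] := C2_at_row_mx Ct Cs.
have dFA w : 'd (fun y => row_mx (Ft y) (Fs y)) y0 w = w *m A.
  apply: etrans (dF w) _; rewrite /A mul_mx_row.
  by congr row_mx; exact: diff_mxE.
have kerA w : w *m A = 0 <-> 'd Ft y0 w = 0 /\ 'd Fs y0 w = 0.
  rewrite -dFA (dF w) -row_mx0; split=> [/eq_row_mx[]|[t0 s0]]; first by [].
  by congr row_mx; [exact: t0|exact: s0].
have dFC : \forall y \near y0, forall w,
    'd (fun y => row_mx (Ft y) (Fs y)) y w = row_mx ('d Ft y w) ('d Fs y w).
  by apply: filterS2 (C2_at_near Ct) (C2_at_near Cs) => y Cty /(C2_at_row_mx Cty)[].
have [||c [d [d0 c0 cv cF]]] := constant_rank_curve CF dFA ABA BAB (v := v).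
- exact/kerA.
- move=> e e0; apply: filterS2 dFC (HT e e0) => y dFy Ty FB.
  have /Ty[T TP] : Ft y = Ft y0.
    apply/eqP; rewrite -subr_eq0; apply/eqP; apply: Bt (Fs y - Fs y0) _.
    by rewrite -FB opp_row_mx add_row_mx.
  exists T => xi /kerA[t0 s0]; have [h1 h2 h3] := TP xi t0 s0.
  split; last exact: h3.
  by apply: etrans (dFy _) _; rewrite -row_mx0; congr row_mx;
    [exact: h1|exact: h2].
exists c, d; split=> // s /cF/eq_row_mx[]; by split.
Qed.

Lemma sum_pair_delta_l n k (w : 'rV[R]_n) :
  \sum_i w ord0 i *: (delta_mx ord0 i : 'rV[R]_n, 0 : 'rV[R]_k) = (w, 0).
Proof.
rewrite [in RHS](row_sum_delta w).
rewrite (big_morph (fun a : 'rV[R]_n => (a, 0 : 'rV[R]_k)) (id1 := 0)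
  (op1 := +%R))//.
  by apply: eq_bigr => i _; congr pair; rewrite scaler0.
by move=> a b; congr pair; rewrite addr0.
Qed.

Lemma sum_pair_delta_r n k (w : 'rV[R]_n) :
  \sum_i w ord0 i *: (0 : 'rV[R]_k, delta_mx ord0 i : 'rV[R]_n) = (0, w).
Proof.
rewrite [in RHS](row_sum_delta w).
rewrite (big_morph (fun a : 'rV[R]_n => (0 : 'rV[R]_k, a)) (id1 := 0)
  (op1 := +%R))//.
  by apply: eq_bigr => i _; congr pair; rewrite scaler0.
by move=> a b; congr pair; rewrite addr0.
Qed.

Lemma diff_mx_rows (V : normedModType R) n k (F : V -> 'rV[R]_k) (z : V)
    (e : 'I_n -> V) (w : 'rV[R]_n) :
  w *m (\matrix_i 'd F z (e i)) = 'd F z (\sum_i w ord0 i *: e i).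
Proof.
rewrite mulmx_sum_row [RHS]linear_sum; apply: eq_bigr => i _.
by rewrite rowK [RHS]linearZ.
Qed.

End Calculus.

(** * Curves in manifolds *)

Section Curves.
Context {R : realType}.

(** Continuity does not follow from the last clause: the chart is a total function with arbitrary
    values outside its domain, so its composite with [c] does not keep [c] near [p]. *)
Definition curve_at (M : manifold R) (c : R -> M) (p : M)
    (v : 'rV[R]_(mdim M)) : Prop :=
  [/\ c 0 = p, {for 0, continuous c} & is_derive (0 : R) 1 (chart_at p \o c) v].

Lemma curve_at_cst (M : manifold R) (p : M) : curve_at (fun=> p) p 0.
Proof.
split=> //; first exact: cvg_cst.
exact: is_derive_cst.
Qed.

Lemma curve_near (T : topologicalType) (c : R -> T) (p : T) (P : set T) :
  c 0 = p -> {for 0, continuous c} -> nbhs p P -> \forall s \near (0 : R), P (c s).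
Proof. by move=> <- cc; exact: cc. Qed.

(** Along a curve in [S] the extension agrees with the map itself, so the velocity of the image is
    the same whichever [F] is taken. This is how [diff_left], [Ad] and [tangent_mul] are
    evaluated. *)
Lemma local_extension_curve (T T' : topologicalType) (V W : normedModType R)
    (S : set T) (phi : T -> V) (psi : T' -> W) (f : T -> T') (p : T) (F : V -> W)
    (c : R -> T) (v : V) :
  local_extension S phi psi f p F ->
  c 0 = p -> {for 0, continuous c} -> (\forall s \near (0 : R), S (c s)) ->
  is_derive (0 : R) 1 (phi \o c) v ->
  is_derive (0 : R) 1 (psi \o f \o c) ('d F (phi p) v).
Proof.
move=> [sF EF] c0 cc Sc dc.
have dF : differentiable F ((phi \o c) 0).
  by rewrite /= c0; have [] := nbhs_singleton (smooth_at_C2 sF).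
have := is_derive1_diff_comp dF dc; rewrite /= c0.
apply: near_eq_is_derive.
have : \forall s \near (0 : R), S (c s) -> psi (f (c s)) = F (phi (c s)).
  exact: curve_near EF.
by apply: filterS2 Sc => s Ss /(_ Ss)/esym.
Qed.

Lemma chart_inv_near (M : manifold R) (p : M) :
  \forall y \near chart_at p p, chart_dom (chart_at p) (chart_inv (chart_at p) y)
    /\ chart_at p (chart_inv (chart_at p) y) = y.
Proof.
have : nbhs (chart_at p p) (chart_at p @` chart_dom (chart_at p)).
  apply: open_nbhs_nbhs; split; first exact: open_chart_img.
  by exists p => //; exact: chart_at_dom.
by apply: filterS => _ [q qd <-]; rewrite chart_mapK.
Qed.

Lemma chart_dom_near (M : manifold R) (p : M) :
  \forall q \near p, chart_dom (chart_at p) q.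
Proof.
apply: open_nbhs_nbhs; split; [exact: open_chart_dom|exact: chart_at_dom].
Qed.

Lemma nbhs_chart (M : manifold R) (p : M) (P : set 'rV[R]_(mdim M)) :
  nbhs (chart_at p p) P -> \forall q \near p, P (chart_at p q).
Proof.
by move=> nP; apply: (@chart_map_continuous _ _ _ (chart_at p) p) => //;
  exact: chart_at_dom.
Qed.

Lemma nbhs_chart_inv (M : manifold R) (p : M) (P : set M) :
  nbhs p P -> \forall y \near chart_at p p, P (chart_inv (chart_at p) y).
Proof.
have E : chart_inv (chart_at p) (chart_at p p) = p.
  by rewrite chart_mapK//; exact: chart_at_dom.
rewrite -[X in nbhs X P]E.
by apply: (@chart_inv_continuous _ _ _ (chart_at p) p); exact: chart_at_dom.
Qed.

Lemma curve_at_coord (M : manifold R) (p : M) (c : R -> 'rV[R]_(mdim M)) v :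
  c 0 = chart_at p p -> is_derive (0 : R) 1 c v ->
  curve_at (chart_inv (chart_at p) \o c) p v /\
  \forall s \near (0 : R), chart_at p (chart_inv (chart_at p) (c s)) = c s.
Proof.
move=> c0 dc; have cc : {for 0, continuous c}.
  by apply: differentiable_continuous; apply/derivable1_diffP; case: dc.
have near_c : \forall s \near (0 : R),
    chart_at p (chart_inv (chart_at p) (c s)) = c s.
  have H : nbhs (chart_at p p)
      [set y | chart_at p (chart_inv (chart_at p) y) = y].
    by apply: filterS (chart_inv_near p) => y [].
  exact: (curve_near c0 cc H).
split=> //; split.
- by rewrite /= c0 chart_mapK//; exact: chart_at_dom.
- apply: continuous_comp => //; rewrite c0; apply: chart_inv_continuous.
  exact: chart_at_dom.
- by apply: near_eq_is_derive dc; apply: filterS near_c => s /= ->.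
Qed.

Lemma smooth_map_ext (M N : manifold R) (f : M -> N) (p : M) :
  smooth_map f -> {for p, continuous f} /\
  exists F, [/\ C2_at F (chart_at p p),
    (forall v, mdiff f p v = 'd F (chart_at p p) v) &
    \forall q \near p, chart_at (f p) (f q) = F (chart_at p q)].
Proof.
move=> /(_ p)[]; rewrite withinET => cf [F [sF]]; rewrite withinET => EF.
split=> //; exists F; split=> // [|v]; first exact: smooth_at_C2.
have dF : differentiable F (chart_at p p).
  by have [] := nbhs_singleton (smooth_at_C2 sF).
rewrite /mdiff lfunE /=.
have E1 : \forall y \near chart_at p p,
    chart_at (f p) (f (chart_inv (chart_at p) y)) =
    F (chart_at p (chart_inv (chart_at p) y)).
  exact: (nbhs_chart_inv EF).
have E2 : \forall y \near chart_at p p,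
    F y = (chart_at (f p) \o f \o chart_inv (chart_at p)) y.
  by apply: filterS2 E1 (chart_inv_near p) => y /= -> [_ ->].
have [_ dE] := is_diff_near_eq E2 dF; exact: (congr1 (fun h => h v) dE).
Qed.

Lemma curve_at_smooth_map (M N : manifold R) (f : M -> N) (p : M) (c : R -> M) v :
  smooth_map f -> curve_at c p v -> curve_at (f \o c) (f p) (mdiff f p v).
Proof.
move=> /(smooth_map_ext p)[cf [F [CF dF EF]]] [c0 cc dc]; split.
- by rewrite /= c0.
- by apply: continuous_comp => //; rewrite c0.
- have dF0 : differentiable F ((chart_at p \o c) 0).
    by rewrite /= c0; have [] := nbhs_singleton CF.
  have := is_derive1_diff_comp dF0 dc; rewrite /= c0 -dF.
  apply: near_eq_is_derive.
  have : \forall s \near (0 : R), chart_at (f p) (f (c s)) = F (chart_at p (c s)).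
    exact: curve_near EF.
  by apply: filterS => s /= ->.
Qed.

Lemma mdiff_curve_cst (M N : manifold R) (f : M -> N) (p : M) (c : R -> M) v :
  smooth_map f -> curve_at c p v -> (\forall s \near (0 : R), f (c s) = f p) ->
  mdiff f p v = 0.
Proof.
move=> sf cv fc; have [_ _ h] := curve_at_smooth_map sf cv.
apply: is_derive_uniq h _.
have E : \forall s \near (0 : R), (cst (chart_at (f p) (f p)) : R -> _) s =
    (chart_at (f p) \o (f \o c)) s by apply: filterS fc => s /= ->.
exact: near_eq_is_derive E (is_derive_cst _ _ _).
Qed.

(** The chart at [f p] is injective only on its domain; continuity of [f] brings [f q] into it. *)
Lemma level_near (M N : manifold R) (f : M -> N) (p : M) F :
  {for p, continuous f} ->
  (\forall q \near p, chart_at (f p) (f q) = F (chart_at p q)) ->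
  \forall q \near p, F (chart_at p q) = F (chart_at p p) -> f q = f p.
Proof.
move=> cf EF; have Ep := nbhs_singleton EF.
have H : \forall q \near p, chart_dom (chart_at (f p)) (f q).
  by apply: cf; exact: chart_dom_near.
apply: filterS2 EF H => q Eq dq h.
rewrite -(chart_mapK dq) Eq h -Ep chart_mapK//; exact: chart_at_dom.
Qed.

Lemma submersion_right_inverse (M N : manifold R) (f : M -> N) (p : M) F :
  submersion f -> (forall v, mdiff f p v = 'd F (chart_at p p) v) ->
  exists B, B *m lin1_mx ('d F (chart_at p p)) = 1%:M.
Proof.
move=> [_ /(_ p) fp] dF; apply: right_inverse_mx => w.
have : w \in limg (mdiff f p) by rewrite fp memvf.
by move=> /memv_imgP[u _ ->]; exists u; rewrite dF diff_mxE.
Qed.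

Lemma submersion_curve (M N : manifold R) (f : M -> N) (p : M) v :
  submersion f -> mdiff f p v = 0 ->
  exists2 c, curve_at c p v & \forall s \near (0 : R), f (c s) = f p.
Proof.
move=> sf; have [cf [F [CF dF EF]]] := smooth_map_ext p sf.1.
rewrite dF diff_mxE => vA.
have [B BA] := submersion_right_inverse sf dF.
have BAB : B *m lin1_mx ('d F (chart_at p p)) *m B = B by rewrite BA mul1mx.
have [c [d [K [d0 c0 cv _ cB]]]] := level_curve CF (diff_mxE F _) BAB vA.
have [cc Ec] := curve_at_coord c0 cv.
exists (chart_inv (chart_at p) \o c) => //; case: cc => cc0 cc _.
have := curve_near cc0 cc (level_near cf EF).
have nd : \forall s \near (0 : R), `|s| < d by exact: nbhs0_lt.
(* Here B A = 1, so multiplying by A recovers F - F y0 from (F - F y0) B = 0. *)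
apply: filterS3 nd Ec => s sd Es; rewrite /= Es; apply; apply/eqP.
by rewrite -subr_eq0 -[X in X == _]mulmx1 -BA mulmxA cB// mul0mx.
Qed.

Lemma tangent_coord_curve (M : manifold R) (p q : M) (c : R -> M) w :
  chart_dom (chart_at p) q -> curve_at c q w ->
  is_derive (0 : R) 1 (chart_at p \o c) (tangent_coord p q w).
Proof.
move=> pq [c0 cc dc].
have dpq : differentiable (chart_at p \o chart_inv (chart_at q)) (chart_at q q).
  have [+ _] := chart_compat q p 1; apply.
  by exists q => //; split=> //; exact: chart_at_dom.
have E0 : (chart_at q \o c) 0 = chart_at q q by rewrite /= c0.
rewrite -E0 in dpq; have := is_derive1_diff_comp dpq dc.
rewrite E0 -/(tangent_coord p q w); apply: near_eq_is_derive.
have := curve_near c0 cc (chart_dom_near q).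
by apply: filterS => s cs; rewrite /= chart_mapK.
Qed.

Lemma lker_mdiffP (M N : manifold R) (f : M -> N) (p : M) (v : tangent p) :
  v \in lker (mdiff f p) <-> mdiff f p v = 0.
Proof.
rewrite memv_ker; split=> [/eqP|h]; first exact.
by apply/eqP; exact: h.
Qed.

End Curves.

Section Groupoid.
Context {R : realType} {G : lie_groupoid R}.
Local Notation Arr := (arrows G).
Local Notation Obj := (objects G).
Local Notation V := 'rV[R]_(mdim (arrows G)).

(** * Curves in the isotropy groups *)

Lemma isotropy_algebraP (x : Obj) v :
  v \in isotropy_algebra x <->
  mdiff (@tgt R G) (one x) v = 0 /\ mdiff (@src R G) (one x) v = 0.
Proof.
rewrite /isotropy_algebra /algebroid memv_cap; split=> [/andP[h1 h2]|[h1 h2]].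
- by split; [exact: (lker_mdiffP _ _).1 h1|exact: (lker_mdiffP _ _).1 h2].
- apply/andP; split; first exact: (lker_mdiffP _ _).2 h1.
  exact: (lker_mdiffP _ _).2 h2.
Qed.

Lemma mul_one_one (x : Obj) : mul (one x) (one x) = one x.
Proof. by have := mul1g (one x); rewrite tgt_one. Qed.

Lemma src_one_tgt_one (x : Obj) : src (one x) = tgt (one x).
Proof. by rewrite src_one tgt_one. Qed.

Lemma curve_at_mul_ext (g h : Arr) (c d : R -> Arr) (v w : V) F :
  src g = tgt h -> curve_at c g v -> curve_at d h w ->
  (\forall s \near (0 : R), src (c s) = tgt (d s)) ->
  local_extension (@composable R G)
    (fun ab : Arr * Arr => (chart_at g ab.1, chart_at h ab.2))
    (chart_at (mul g h)) (fun ab => mul ab.1 ab.2) (g, h) F ->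
  curve_at (fun s => mul (c s) (d s)) (mul g h)
    ('d F (chart_at g g, chart_at h h) (v, w)).
Proof.
move=> gh [c0 cc dc] [d0 cd dd] cmp EF.
have ccd : {for 0, continuous (fun s : R => (c s, d s))} by exact: cvg_pair.
split; first by rewrite c0 d0.
- have [+ _] := mul_smooth gh => cm.
  have cm' : (fun ab : Arr * Arr => mul ab.1 ab.2) @ within (@composable R G)
    (nbhs (g, h)) --> mul g h by exact: cm.
  move=> P /=; rewrite c0 d0 => /cm' nP.
  have H : nbhs (g, h)
      [set ab : Arr * Arr | src ab.1 = tgt ab.2 -> P (mul ab.1 ab.2)].
    exact: nP.
  have cd0 : (c 0, d 0) = (g, h) by rewrite c0 d0.
  have := curve_near cd0 ccd H.
  by apply: filterS2 cmp => s cs /(_ cs).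
- apply: (local_extension_curve EF (c := fun s => (c s, d s))) => //.
    by rewrite c0 d0.
  exact: is_derive_pair.
Qed.

Lemma tangent_mul_curve (g h : Arr) (c d : R -> Arr) (v w u : V) :
  src g = tgt h -> curve_at c g v -> curve_at d h w ->
  (\forall s \near (0 : R), src (c s) = tgt (d s)) ->
  tangent_mul g h v w u ->
  curve_at (fun s => mul (c s) (d s)) (mul g h) u.
Proof.
by move=> gh cg dh cmp [F [EF ->]]; exact: curve_at_mul_ext EF.
Qed.

Lemma tangent_mul_ex (g h : Arr) (v w : V) :
  src g = tgt h -> exists u, tangent_mul g h v w u.
Proof.
move=> /mul_smooth[_ [F EF]].
by exists ('d F (chart_at g g, chart_at h h) (v, w)), F.
Qed.

(** [m] is the multiplication in the chart at the unit. [W] is free so that the products can be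
    confined to where the coordinate expressions of source and target hold. *)
Lemma mul_near_one (x : Obj) :
  exists m : V * V -> V,
    C2_at m (chart_at (one x) (one x), chart_at (one x) (one x)) /\
    forall W, nbhs (one x) W -> exists2 U, nbhs (one x) U &
      forall g h, U g -> U h -> src g = tgt h -> W (mul g h) /\
        chart_at (one x) (mul g h) = m (chart_at (one x) g, chart_at (one x) h).
Proof.
have := mul_smooth (src_one_tgt_one x).
rewrite /smooth_within /= mul_one_one => -[cm [m [sm Em]]].
exists m; split; first exact: smooth_at_C2.
move=> W /cm nW.
have nW' : nbhs (one x, one x)
  [set ab : Arr * Arr | src ab.1 = tgt ab.2 -> W (mul ab.1 ab.2)] by exact: nW.
have Em' : nbhs (one x, one x) [set ab : Arr * Arr | src ab.1 = tgt ab.2 ->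
    chart_at (one x) (mul ab.1 ab.2) =
      m (chart_at (one x) ab.1, chart_at (one x) ab.2)] by exact: Em.
have [[U1 U2] /= [nU1 nU2] U12] : nbhs (one x, one x)
  [set ab : Arr * Arr | src ab.1 = tgt ab.2 -> W (mul ab.1 ab.2) /\
    chart_at (one x) (mul ab.1 ab.2) =
      m (chart_at (one x) ab.1, chart_at (one x) ab.2)].
  by apply: filterS2 nW' Em' => ab Wab mab cab; split; [exact: Wab|exact: mab].
exists (U1 `&` U2) => [|g h [g1 _] [_ h2] gh]; first exact: filterI.
exact: (U12 (g, h)).
Qed.

Lemma is_derive_mul_chart n
    (phi : Arr -> 'rV[R]_n) (m : 'rV[R]_n * 'rV[R]_n -> 'rV[R]_n)
    (U : set (Arr)) (c d : R -> Arr) v w :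
  (forall g h, U g -> U h -> src g = tgt h -> phi (mul g h) = m (phi g, phi h)) ->
  (\forall s \near (0 : R), [/\ U (c s), U (d s) & src (c s) = tgt (d s)]) ->
  is_derive (0 : R) 1 (phi \o c) v -> is_derive (0 : R) 1 (phi \o d) w ->
  differentiable m (phi (c 0), phi (d 0)) ->
  is_derive (0 : R) 1 (fun s => phi (mul (c s) (d s)))
    ('d m (phi (c 0), phi (d 0)) (v, w)).
Proof.
move=> mU Ucd dc dd dm.
have := is_derive1_diff_comp dm (is_derive_pair dc dd).
apply: near_eq_is_derive.
by apply: filterS Ucd => s [Uc Ud cd] /=; rewrite mU.
Qed.

(** [T] is the right translation by an arrow g of the target fibre, d_1 m(y0, y) in coordinates. The
    curve h(s) g has constant source, and its target is that of h(s), stationary to first order. So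
    h need only lie in a source fibre, where submersivity provides it before any curve in G_x is
    known. *)
Lemma isotropy_curve (x : Obj) v :
  v \in isotropy_algebra x ->
  exists2 c, curve_at c (one x) v &
    \forall s \near (0 : R), src (c s) = x /\ tgt (c s) = x.
Proof.
move=> /isotropy_algebraP[tv sv].
pose p := one x; pose phi : Arr -> V := chart_at p.
pose y0 := phi p.
have [ct [Ft [Ct dFt Et]]] := smooth_map_ext p (tgt_submersion G).1.
have [cs [Fs [Cs dFs Es]]] := smooth_map_ext p (src_submersion G).1.
have [B1 BAt] := submersion_right_inverse (tgt_submersion G) dFt.
have [m [Cm mU]] := mul_near_one x.
have [U nU UP] := mU _ (filterI Et Es).
have src_curve xi : mdiff (@src R G) p xi = 0 -> exists2 h, curve_at h p xi &
    \forall s \near (0 : R), src (h s) = x.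
  by move=> /(submersion_curve (src_submersion G)); rewrite src_one.
(* Right translation by the unit is the identity on ker ds; hence [T] is near the identity for g
   near the unit. *)
have m_id xi : mdiff (@src R G) p xi = 0 -> 'd m (y0, y0) (xi, 0) = xi.
  move=> /src_curve[h [h0 hc hd] hs].
  have Uh := curve_near h0 hc nU.
  have D : is_derive (0 : R) 1 (fun s => phi (mul (h s) p))
      ('d m (phi (h 0), phi p) (xi, 0)).
    apply: (@is_derive_mul_chart _ phi m U h (fun=> p)) => //.
    - by move=> a b Ua Ub ab; have [] := UP a b Ua Ub ab.
    - by apply: filterS2 Uh hs => s Us ss; split=> //;
        [exact: nbhs_singleton nU|rewrite ss tgt_one].
    - exact: is_derive_cst.
    - by rewrite h0; have [] := nbhs_singleton Cm.
  rewrite h0 in D; apply: is_derive_uniq D _.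
  apply: near_eq_is_derive hd; apply: filterS hs => s ss /=.
  by have -> : mul (h s) p = h s by rewrite /p -ss mulg1.
have HT (e : R) : 0 < e -> \forall y \near y0, Ft y = Ft y0 ->
    exists T : 'M[R]_(mdim (Arr)), forall xi, 'd Ft y0 xi = 0 -> 'd Fs y0 xi = 0 ->
      [/\ 'd Ft y (xi *m T) = 0, 'd Fs y (xi *m T) = 0 &
          `|xi *m T - xi| <= e * `|xi|].
  move=> e0.
  have Ue := nbhs_chart_inv nU.
  have Lt := nbhs_chart_inv (level_near ct Et).
  have Dm := near_pair_r Cm.
  have Dm' : \forall y \near y0, forall xi : V,
      `|'d m (y0, y) (xi, 0) - 'd m (y0, y0) (xi, 0)| <= e * `|xi|.
    apply: filterS (near_pair_r (diff_near_le (fun i : 'I_(mdim (Arr)) =>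
      (delta_mx ord0 i : V,
       0 : V)) Cm e0)) => y H xi.
    by rewrite -!sum_pair_delta_l; exact: H.
  near=> y => Fty.
  have Ug : U (chart_inv (chart_at p) y) by near: y.
  have gy : phi (chart_inv (chart_at p) y) = y.
    by near: y; apply: filterS (chart_inv_near p) => y [].
  have tg : Ft (phi (chart_inv (chart_at p) y)) = Ft (phi p) ->
      tgt (chart_inv (chart_at p) y) = tgt p by near: y.
  have Fty' : differentiable Ft y by near: y; apply: filterS Ct => y [].
  have Fsy' : differentiable Fs y by near: y; apply: filterS Cs => y [].
  have my : differentiable m (y0, y) by near: y; apply: filterS Dm => y [].
  have My : forall xi : V,
      `|'d m (y0, y) (xi, 0) - 'd m (y0, y0) (xi, 0)| <= e * `|xi| by near: y.
  move: Ug gy tg; set g := chart_inv (chart_at p) y => Ug gy tg.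
  rewrite gy tgt_one in tg; have {}tg := tg Fty.
  exists (\matrix_i 'd m (y0, y) (delta_mx ord0 i, 0)) => xi.
  rewrite diff_mx_rows sum_pair_delta_l => txi sxi.
  have {}txi : mdiff (@tgt R G) p xi = 0 := etrans (dFt xi) txi.
  have {}sxi : mdiff (@src R G) p xi = 0 := etrans (dFs xi) sxi.
  have [h [h0 hc hd] hs] := src_curve _ sxi.
  have Uh := curve_near h0 hc nU.
  have D : is_derive (0 : R) 1 (fun s => phi (mul (h s) g))
      ('d m (y0, y) (xi, 0)).
    rewrite -gy -[y0]/(phi p) -h0.
    apply: (@is_derive_mul_chart _ phi m U h (fun=> g)) => //.
    - by move=> a b Ua Ub ab; have [] := UP a b Ua Ub ab.
    - by apply: filterS2 Uh hs => s Us ss; split=> //; rewrite ss tg.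
    - exact: is_derive_cst.
    - by rewrite h0 gy.
  have kE : phi (mul (h 0) g) = y.
    by rewrite h0 /p -tg mul1g.
  have near_k : \forall s \near (0 : R),
      Ft (phi (mul (h s) g)) = Ft (phi (h s)) /\
      Fs (phi (mul (h s) g)) = chart_at (src p) (src g).
    apply: filterS3 Uh hs (curve_near h0 hc Et) => s Us ss Eh.
    have sg : src (h s) = tgt g by rewrite ss tg.
    have [[E1 E2] _] := UP (h s) g Us Ug sg.
    by rewrite -[Ft _]E1 -[Fs _]E2 src_mul// tgt_mul.
  have DF k (F : V -> 'rV[R]_k) : differentiable F y ->
    is_derive (0 : R) 1 (F \o (fun s => phi (mul (h s) g)))
      ('d F y ('d m (y0, y) (xi, 0))).
    by move=> Fy; rewrite -[in 'd F y]kE; apply: is_derive1_diff_comp D; rewrite kE.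
  split.
  - apply: is_derive_uniq (DF _ Ft Fty') _.
    have dFt0 : differentiable Ft ((chart_at p \o h) 0).
      by rewrite /= h0; have [] := nbhs_singleton Ct.
    have := is_derive1_diff_comp dFt0 hd; rewrite [(_ \o _) 0]/= h0.
    have -> : 'd Ft (chart_at p p) xi = 0 := etrans (esym (dFt xi)) txi.
    by apply: near_eq_is_derive; apply: filterS near_k => s [].
  - apply: is_derive_uniq (DF _ Fs Fsy') _.
    have Ek : \forall s \near (0 : R), (cst (chart_at (src p) (src g)) : R -> _) s =
        (Fs \o (fun s => phi (mul (h s) g))) s by apply: filterS near_k => s [].
    exact: near_eq_is_derive Ek (is_derive_cst _ _ _).
  - by have := My xi; rewrite [X in _ - X]m_id.
have [||c [d [d0 c0 cv cF]]] := constant_rank_curve_pair Ct Cs BAt _ _ HT (v := v).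
- exact: etrans (esym (dFt v)) tv.
- exact: etrans (esym (dFs v)) sv.
have [cc Ec] := curve_at_coord c0 cv.
exists (chart_inv (chart_at p) \o c) => //; case: cc => cc0 cc _.
have nd : \forall s \near (0 : R), `|s| < d by exact: nbhs0_lt.
have ndE : \forall s \near (0 : R), `|s| < d /\
    chart_at p (chart_inv (chart_at p) (c s)) = c s by exact: filterI.
have Lt := curve_near cc0 cc (level_near ct Et).
have Ls := curve_near cc0 cc (level_near cs Es).
apply: filterS3 ndE Lt Ls => s [/cF[tcs scs] Ecs].
by rewrite /= Ecs src_one tgt_one => /(_ tcs)-> /(_ scs)->.
Unshelve. all: by end_near. Qed.

(** * The bracket of the isotropy Lie algebra *)

Lemma diff_left_curve (g : Arr) v w (h : R -> Arr) :
  curve_at h (one (src g)) v -> (\forall s \near (0 : R), tgt (h s) = src g) ->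
  diff_left g v w -> curve_at (fun s => mul g (h s)) g w.
Proof.
move=> hv hs [F [EF ->]].
have gone : src g = tgt (one (src g)) by rewrite tgt_one.
(* This extension gives the value at 0 and the continuity; the velocity comes from [F]. *)
have [_ [F2 EF2]] := mul_smooth gone.
have hs' : \forall s \near (0 : R), src g = tgt (h s).
  by apply: filterS hs => s ->.
have [k0 kc _] := curve_at_mul_ext gone (curve_at_cst g) hv hs' EF2.
rewrite mulg1 in k0; split=> //.
have [h0 hc hd] := hv.
have := local_extension_curve EF h0 hc hs hd.
by rewrite mulg1.
Qed.

Lemma left_invariant_curve (x : Obj) (g : Arr) c Z (h : R -> Arr) :
  left_invariant_field c Z -> src g = x -> curve_at h (one x) (c x) ->
  (\forall s \near (0 : R), tgt (h s) = x) ->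
  curve_at (fun s => mul g (h s)) g (Z g).
Proof.
move=> [_ LZ] sg; case: _ / sg => hc hs.
exact: diff_left_curve hc hs (LZ g).
Qed.

Lemma left_invariant_one (x : Obj) c Z :
  left_invariant_field c Z -> c x \in isotropy_algebra x -> Z (one x) = c x.
Proof.
move=> LZ /isotropy_curve[h [h0 hc hd] hs].
have ht : \forall s \near (0 : R), tgt (h s) = x.
  by apply: filterS hs => s [].
have [_ _ hZ] := left_invariant_curve LZ (src_one x) (And3 h0 hc hd) ht.
apply: is_derive_uniq hZ _.
apply: near_eq_is_derive hd; apply: filterS ht => s /= ts.
by rewrite -[in X in mul X _]ts mul1g.
Qed.

Definition mul_coord (x : Obj)
    (m : V * V ->
         V) (U : set (Arr)) : Prop :=
  [/\ C2_at m (chart_at (one x) (one x), chart_at (one x) (one x)),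
      nbhs (one x) U &
      forall g h, U g -> U h -> src g = tgt h ->
        chart_at (one x) (mul g h) = m (chart_at (one x) g, chart_at (one x) h)].

Lemma mul_coord_ex (x : Obj) : exists m U, mul_coord x m U.
Proof.
have [m [Cm mU]] := mul_near_one x.
have [U nU UP] := mU _ (filterT : nbhs (one x) setT).
by exists m, U; split=> // g h Ug Uh gh; have [] := UP g h Ug Uh gh.
Qed.

(* Invariance of [l] under [Ad_g] for the isotropy arrows [g] at [x], with curves
   [h] and [h' = g^-1 h g] through the unit in the place of tangent vectors. *)
Definition conj_closed (x : Obj) (l : {vspace V}) :=
  forall g v, src g = x -> tgt g = x -> v \in l ->
    exists v' h h', [/\ v' \in l, curve_at h (one x) v, curve_at h' (one x) v' &
      \forall s \near (0 : R), [/\ src (h s) = x, tgt (h' s) = x &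
        mul (h s) g = mul g (h' s)]].

Section Bracket.
Context (x : Obj) (m : V * V -> V) (U : set Arr) (mU : mul_coord x m U).
Let phi : Arr -> V := chart_at (one x).
Let y0 := phi (one x).

(** For g in [U] this differential of [m] is dL_g read in the chart at the unit, with no change of
    chart as g moves. *)
Lemma left_speed (g : Arr) (h : R -> Arr) xi :
  U g -> differentiable m (phi g, y0) -> curve_at h (one x) xi ->
  (\forall s \near (0 : R), src g = tgt (h s)) ->
  is_derive (0 : R) 1 (fun s => phi (mul g (h s))) ('d m (phi g, y0) (0, xi)).
Proof.
move=> Ug dm [h0 hc hd] gh; have [Cm nU UP] := mU.
rewrite /y0 -h0.
apply: (@is_derive_mul_chart _ phi m U (fun=> g) h) => //.
- by apply: filterS2 (curve_near h0 hc nU) gh => s Us ->.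
- exact: is_derive_cst.
- by rewrite h0.
Qed.

Lemma right_speed (g : Arr) (h : R -> Arr) xi :
  U g -> differentiable m (y0, phi g) -> curve_at h (one x) xi ->
  (\forall s \near (0 : R), src (h s) = tgt g) ->
  is_derive (0 : R) 1 (fun s => phi (mul (h s) g)) ('d m (y0, phi g) (xi, 0)).
Proof.
move=> Ug dm [h0 hc hd] gh; have [Cm nU UP] := mU.
rewrite /y0 -h0.
apply: (@is_derive_mul_chart _ phi m U h (fun=> g)) => //.
- by apply: filterS2 (curve_near h0 hc nU) gh => s Us ->.
- exact: is_derive_cst.
- by rewrite h0.
Qed.

Lemma left_speed_one xi : xi \in isotropy_algebra x -> 'd m (y0, y0) (0, xi) = xi.
Proof.
have [Cm nU _] := mU.
move=> /isotropy_curve[h hc hs].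
have dm : differentiable m (phi (one x), y0) by have [] := nbhs_singleton Cm.
have hs' : \forall s \near (0 : R), src (one x) = tgt (h s).
  by apply: filterS hs => s [_ ->]; rewrite src_one.
apply: is_derive_uniq (left_speed (nbhs_singleton nU) dm hc hs') _.
have [_ _ hd] := hc; apply: near_eq_is_derive hd.
apply: filterS hs => s [_ ts] /=.
by rewrite -[in X in mul X _]ts mul1g.
Qed.

Lemma right_speed_one xi : xi \in isotropy_algebra x -> 'd m (y0, y0) (xi, 0) = xi.
Proof.
have [Cm nU _] := mU.
move=> /isotropy_curve[h hc hs].
have dm : differentiable m (y0, phi (one x)) by have [] := nbhs_singleton Cm.
have hs' : \forall s \near (0 : R), src (h s) = tgt (one x).
  by apply: filterS hs => s [-> _]; rewrite tgt_one.
apply: is_derive_uniq (right_speed (nbhs_singleton nU) dm hc hs') _.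
have [_ _ hd] := hc; apply: near_eq_is_derive hd.
apply: filterS hs => s [ss _] /=.
by rewrite -[in X in mul _ X]ss mulg1.
Qed.

(** Both sides are the velocity of g h(s), h being a curve in G_x of velocity [c x]. At arrows with
    source x the field is determined by the single value [c x]. *)
Lemma left_invariant_coord (g : Arr) c Z :
  left_invariant_field c Z -> c x \in isotropy_algebra x ->
  src g = x -> U g -> chart_dom (chart_at (one x)) g ->
  differentiable m (phi g, y0) ->
  tangent_coord (one x) g (Z g) = 'd m (phi g, y0) (0, c x).
Proof.
move=> LZ /isotropy_curve[h hc hs] sg Ug dg dm.
have ht : \forall s \near (0 : R), tgt (h s) = x by apply: filterS hs => s [].
have ht' : \forall s \near (0 : R), src g = tgt (h s).
  by apply: filterS ht => s ->.
have kc := left_invariant_curve LZ sg hc ht.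
exact: is_derive_uniq (tangent_coord_curve dg kc) (left_speed Ug dm hc ht').
Qed.

(** The formula for the field holds at arrows with source x, which need not fill a neighbourhood.
    The field being differentiable, its derivative in the direction [u] can be taken along any curve
    of velocity [u], and one in G_x stays where the formula holds. *)
Lemma field_coord_derive c Z u :
  left_invariant_field c Z -> c x \in isotropy_algebra x ->
  u \in isotropy_algebra x ->
  'D_u (field_coord (one x) Z) y0 =
  'D_(u, 0) (fun z => 'D_(0, c x) m z) (y0, y0).
Proof.
move=> LZ cx /isotropy_curve[g gc gs]; have [Cm nU _] := mU.
have [[_ [F [sF EF]]] _] : smooth_section_at id Z (one x) /\ True.
  by split=> //; have [+ _] := LZ; exact.
have dF : differentiable F y0 by have [] := nbhs_singleton (smooth_at_C2 sF).
have EF' : \forall q \near one x, tangent_coord (one x) q (Z q) = F (phi q).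
  by move: EF; rewrite withinET.
have EZ : \forall y \near y0, F y = field_coord (one x) Z y.
  apply: filterS2 (nbhs_chart_inv EF') (chart_inv_near (one x)) => y + [_ yE].
  by rewrite /field_coord /= => ->; rewrite /phi yE.
have [dZ dZE] := is_diff_near_eq EZ dF.
have -> : 'D_u (field_coord (one x) Z) y0 = 'd F y0 u.
  by rewrite (deriveE _ dZ); exact: (congr1 (fun h => h u) dZE).
have [g0 gcont gd] := gc.
have dF0 : differentiable F ((phi \o g) 0) by rewrite /= g0.
have D1 := is_derive1_diff_comp dF0 gd.
have dD : differentiable (fun z => 'D_(0, c x) m z) (phi (g 0), y0).
  by rewrite g0; have [_] := nbhs_singleton Cm.
have D2 := is_derive1_diff_comp (c := fun s => (phi (g s), y0)) dD
  (is_derive_pair gd (is_derive_cst y0 (0 : R) 1)).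
rewrite -(deriveE _ dD) g0 in D2; rewrite [(phi \o g) 0]/= g0 in D1.
apply: is_derive_uniq D1 _; apply: near_eq_is_derive D2.
have Dm : \forall q \near one x, differentiable m (phi q, y0).
  have Dm0 : nbhs y0 [set y | differentiable m (y, y0)].
    by apply: filterS (near_pair_l Cm) => y [].
  exact: nbhs_chart Dm0.
have N1 : \forall q \near one x, [/\ differentiable m (phi q, y0), U q,
    chart_dom (chart_at (one x)) q & tangent_coord (one x) q (Z q) = F (phi q)].
  exact: near_and4 Dm nU (chart_dom_near (one x)) EF'.
apply: filterS2 gs (curve_near g0 gcont N1) => s [ss _] [ds Us cs Fs] /=.
by rewrite -[F _]Fs (left_invariant_coord LZ cx ss Us cs ds) deriveE.
Qed.

Lemma bracket_in_ideal (l : {vspace V}) u v w :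
  (l <= isotropy_algebra x)%VS ->
  conj_closed x l ->
  u \in isotropy_algebra x -> v \in l -> isotropy_bracket x u v w -> w \in l.
Proof.
move=> lx Hl ux vl [a [b [X [Y [_ [ax bx] [LX LY] ->]]]]].
have [Cm nU UP] := mU.
have vx : v \in isotropy_algebra x by exact: (subvP lx).
have aX : a x \in isotropy_algebra x by rewrite ax.
have bX : b x \in isotropy_algebra x by rewrite bx.
rewrite /lie_bracket (left_invariant_one LX aX) (left_invariant_one LY bX) ax bx.
rewrite [X in X - _](field_coord_derive LY bX ux).
rewrite [X in _ - X](field_coord_derive LX aX vx) ax bx.
(* After this exchange both terms are derivatives along one curve [c] in G_x of velocity [u], placed
   in the first factor in one term and in the second factor in the other. *)
rewrite [X in _ - X](schwarz_rV (0, u) (v, 0) Cm).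
have [c [c0 cc cd] cs] := isotropy_curve ux.
pose f (s : R) := 'D_(0, v) m (phi (c s), y0) - 'D_(v, 0) m (y0, phi (c s)).
have dD z : differentiable (fun y => 'D_z m y) (y0, y0).
  by have [_] := nbhs_singleton Cm.
have phi0 : phi (c 0) = y0 by rewrite c0.
have f0 : f 0 = 0.
  have dm : differentiable m (y0, y0) by have [] := nbhs_singleton Cm.
  by rewrite /f phi0 !deriveE// left_speed_one// right_speed_one// subrr.
apply: (@derive_in_subspace _ _ l f) => //.
- apply: is_deriveB.
  + have dD1 : differentiable (fun y => 'D_(0, v) m y) (phi (c 0), y0).
      by rewrite phi0.
    have := is_derive1_diff_comp (c := fun s => (phi (c s), y0)) dD1
      (is_derive_pair cd (is_derive_cst y0 (0 : R) 1)).
    by rewrite -(deriveE _ dD1) phi0.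
  + have dD1 : differentiable (fun y => 'D_(v, 0) m y) (y0, phi (c 0)).
      by rewrite phi0.
    have := is_derive1_diff_comp (c := fun s => (y0, phi (c s))) dD1
      (is_derive_pair (is_derive_cst y0 (0 : R) 1) cd).
    by rewrite -(deriveE _ dD1) phi0.
move=> e e0.
have N1 : \forall q \near one x, differentiable m (phi q, y0).
  have H : nbhs y0 [set y | differentiable m (y, y0)].
    by apply: filterS (near_pair_l Cm) => y [].
  exact: nbhs_chart H.
have N2 : \forall q \near one x, differentiable m (y0, phi q).
  have H : nbhs y0 [set y | differentiable m (y0, y)].
    by apply: filterS (near_pair_r Cm) => y [].
  exact: nbhs_chart H.
have N3 : \forall q \near one x, forall xi : V,
    `|'d m (phi q, y0) (0, xi) - 'd m (y0, y0) (0, xi)| <= e * `|xi|.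
  have H : nbhs y0 [set y | forall xi : V,
      `|'d m (y, y0) (0, xi) - 'd m (y0, y0) (0, xi)| <= e * `|xi|].
    apply: filterS (near_pair_l (diff_near_le (fun i : 'I_(mdim (Arr)) =>
      (0 : V,
       delta_mx ord0 i : V)) Cm e0)) => y H xi.
    by rewrite -!sum_pair_delta_r; exact: H.
  exact: nbhs_chart H.
have N : \forall q \near one x, [/\ U q, differentiable m (phi q, y0),
    differentiable m (y0, phi q) & forall xi : V,
    `|'d m (phi q, y0) (0, xi) - 'd m (y0, y0) (0, xi)| <= e * `|xi|].
  exact: near_and4 nU N1 N2 N3.
apply: filterS2 cs (curve_near c0 cc N) => s [sg tg] [Ug d1 d2 d3].
(* [v'] is chosen for each s, with no regularity in s. Since h (c s) = (c s) h', [f s] is the left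
   translate of z = v - v' and differs from z by at most e |z|. *)
have [v' [h [h' [v'l hv h'v' hh']]]] := Hl _ _ sg tg vl.
have zl : v - v' \in l by rewrite memvB.
exists (v - v') => //.
have E : 'd m (y0, phi (c s)) (v, 0) = 'd m (phi (c s), y0) (0, v').
  have hs : \forall t \near (0 : R), src (h t) = tgt (c s).
    by apply: filterS hh' => t [-> _ _]; rewrite tg.
  have hs' : \forall t \near (0 : R), src (c s) = tgt (h' t).
    by apply: filterS hh' => t [_ -> _]; rewrite sg.
  apply: is_derive_uniq (right_speed Ug d2 hv hs) _.
  apply: near_eq_is_derive (left_speed Ug d1 h'v' hs').
  by apply: filterS hh' => t [_ _ ->].
have -> : f s = 'd m (phi (c s), y0) (0, v - v').
  rewrite /f [X in X - _](deriveE _ d1) [X in _ - X](deriveE _ d2) [X in _ - X]E.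
  have -> : (0, v - v') = (0, v) - (0, v') :> V * V.
    by congr pair; rewrite subr0.
  by rewrite [RHS]linearB.
have := d3 (v - v'); rewrite [X in _ - X](left_speed_one (subvP lx _ zl)); exact.
Qed.

End Bracket.

(** * Invariance under conjugation *)

Lemma isotropy_ideal_conj_closed (x : Obj)
    (l : {vspace tangent (one x)}) :
  (l <= isotropy_algebra x)%VS -> conj_closed x l -> isotropy_ideal x l.
Proof.
move=> lx lc; split=> // u v w ux vl.
have [m [U mU]] := mul_coord_ex x.
move=> br; apply: (bracket_in_ideal mU lx _ ux vl br); exact: lc.
Qed.

Lemma Ad_curve (g : Arr) v w (h : R -> Arr) :
  curve_at h (one (src g)) v ->
  (\forall s \near (0 : R), src (h s) = src g /\ tgt (h s) = src g) ->
  Ad g v w -> curve_at (fun s => mul (mul g (h s)) (inv g)) (one (tgt g)) w.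
Proof.
move=> hv hs [F [EF ->]].
have gone : src g = tgt (one (src g)) by rewrite tgt_one.
have gh : \forall s \near (0 : R), src g = tgt (h s).
  by apply: filterS hs => s [_ ->].
(* The products in the tangent groupoid serve for the continuity of the conjugated curve; its
   velocity is given by [F]. *)
have [a ga] := tangent_mul_ex 0 v gone.
have ka := tangent_mul_curve gone (curve_at_cst g) hv gh ga.
rewrite mulg1 in ka.
have ginv : src g = tgt (inv g) by rewrite tgt_inv.
have [b gb] := tangent_mul_ex a 0 ginv.
have kb := tangent_mul_curve ginv ka (curve_at_cst (inv g)) _ gb.
have [|k0 kc _] := kb.
  by apply: filterS hs => s [ss ts]; rewrite src_mul ?ts// ss tgt_inv.
rewrite mulgV in k0; split=> //.
have [h0 hc hd] := hv.
have := local_extension_curve EF h0 hc hs hd.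
by rewrite mulg1 mulgV.
Qed.

(** Invariance is used as surjectivity of Ad_g: v is the image of some v' in k, and conjugating by g
    a curve in G_x of velocity v' gives one of velocity v. *)
Lemma bundle_of_ideals_conj_closed
    (k : forall x : Obj, {vspace tangent (one x)}) (x : Obj) :
  bundle_of_ideals k -> conj_closed x (k x).
Proof.
move=> [_ ki kAd] g v sg tg vk.
(* The same bundle with a non-dependent type, all the tangent spaces being one space of rows, so
   that equal base points can be rewritten. *)
pose k' : Obj -> {vspace V} := k.
have vk' : v \in k' (tgt g) by rewrite tg.
have [v' [v'k gv']] := (kAd g v).1 vk'.
have /isotropy_curve[h hv hs] : v' \in isotropy_algebra (src g).
  exact: (subvP (ki _)).
have hc := Ad_curve hv hs gv'.
exists v', (fun s => mul (mul g (h s)) (inv g)), h; split.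
- have : v' \in k' (src g) by [].
  by rewrite sg.
- by rewrite -tg.
- by rewrite -sg.
apply: filterS hs => s [ss ts].
have gh : src g = tgt (h s) by [].
have sgh : src (mul g (h s)) = src g by rewrite src_mul.
split; [|by rewrite ts|].
  by rewrite src_mul ?src_inv// sgh tgt_inv.
by rewrite -mulA ?src_inv// ?tgt_inv// mulVg -sgh mulg1.
Qed.

(** Left translation by the unit is the identity of the target fibre. One direction compares
    velocities; in the other, the identity of the coordinate space is an extension. *)
Lemma translated_bundle_one (k : forall x : Obj, {vspace tangent (one x)})
    (x : Obj) w :
  (forall x, (k x <= isotropy_algebra x)%VS) ->
  translated_bundle k (one x) w <-> w \in k x.
Proof.
move=> ki; pose k' : Obj -> {vspace V} := k.
split=> [[v [vk vw]]|wk].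
- have /isotropy_curve[h hv hs] : v \in isotropy_algebra (src (one x)).
    exact: (subvP (ki _)).
  have ht : \forall s \near (0 : R), tgt (h s) = src (one x).
    by apply: filterS hs => s [].
  have [_ _ hw] := diff_left_curve hv ht vw.
  rewrite src_one in hv ht.
  have -> : w = v.
    apply: is_derive_uniq hw _; have [_ _] := hv.
    apply: near_eq_is_derive; apply: filterS ht => s ts /=.
    by rewrite -[in X in mul X _]ts mul1g.
  have : v \in k' (src (one x)) by [].
  by rewrite src_one.
exists w; split.
  have : w \in k' (src (one x)) by rewrite src_one.
  by [].
exists id; split; last first.
  have -> : 'd (@id V) (chart_at (one (src (one x))) (one (src (one x)))) =
      id :> (_ -> _).
    exact: diff_val.
  by [].
split; first exact: smooth_at_id.
rewrite mulg1; apply: filterS (withinT _ _) => a /=.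
rewrite /tgt_fiber /= src_one => ta.
by have -> : mul (one x) a = a by rewrite -ta mul1g.
Qed.

(* The conjugate of [v] by [g^-1] is the product [0 * (v * 0)] in the tangent
   groupoid, the zero vectors being those at [g^-1] and [g]. *)
Lemma wide_subgroupoid_conj_closed (E : forall g : Arr, {vspace tangent g})
    (x : Obj) :
  wide_lie_subgroupoid E -> conj_closed x (E (one x) :&: isotropy_algebra x)%VS.
Proof.
move=> WE g v sg tg; rewrite memv_cap => /andP[vE vx].
pose E' : Arr -> {vspace V} := E.
have [h hv hs] := isotropy_curve vx.
have cmp1 : src (one x) = tgt g by rewrite src_one tg.
have [r vr] := tangent_mul_ex v 0 cmp1.
have cs1 : \forall s \near (0 : R), src (h s) = tgt g.
  by apply: filterS hs => s [-> _]; rewrite tg.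
have kr := tangent_mul_curve cmp1 hv (curve_at_cst g) cs1 vr.
have onegE : mul (one x) g = g by rewrite -tg mul1g.
have [tv sv] := (isotropy_algebraP v).1 vx.
have rE : r \in E' g.
  have : r \in E' (mul (one x) g).
    have sv0 : mdiff (@src R G) (one x) v = mdiff (@tgt R G) g 0.
      by apply: etrans sv _; rewrite linear0.
    exact: (@wide_mul _ _ _ WE _ _ _ _ _ cmp1 vE (mem0v _) sv0 vr).
  by rewrite onegE.
rewrite onegE in kr.
(* The target velocity of v * 0 vanishes, which makes it composable with the zero vector at g^-1. *)
have tr : mdiff (@tgt R G) g r = 0.
  apply: mdiff_curve_cst (tgt_submersion G).1 kr _.
  by apply: filterS2 hs cs1 => s [_ ts] cs; rewrite tgt_mul// ts tg.
have cmp2 : src (inv g) = tgt g by rewrite src_inv.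
have [v' v'r] := tangent_mul_ex 0 r cmp2.
have cs2 : \forall s \near (0 : R), src (inv g) = tgt (mul (h s) g).
  by apply: filterS2 hs cs1 => s [_ ts] cs; rewrite tgt_mul// ts src_inv.
have kv' := tangent_mul_curve cmp2 (curve_at_cst (inv g)) kr cs2 v'r.
have invgE : mul (inv g) g = one x by rewrite mulVg sg.
rewrite invgE in kv'.
have v'E : v' \in E' (one x).
  have : v' \in E' (mul (inv g) g).
    have tr0 : mdiff (@src R G) (inv g) 0 = mdiff (@tgt R G) g r.
      by apply: etrans (esym tr); rewrite linear0.
    exact: (@wide_mul _ _ _ WE _ _ _ _ _ cmp2 (mem0v _) rE tr0 v'r).
  by rewrite invgE.
have st : \forall s \near (0 : R), src (mul (inv g) (mul (h s) g)) = x /\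
    tgt (mul (inv g) (mul (h s) g)) = x.
  apply: filterS2 cs1 cs2 => s c1 c2.
  by rewrite src_mul// tgt_mul// src_mul// tgt_inv.
have v'x : v' \in isotropy_algebra x.
  apply/isotropy_algebraP; split.
    apply: mdiff_curve_cst (tgt_submersion G).1 kv' _.
    by apply: filterS st => s [_ ->]; rewrite tgt_one.
  apply: mdiff_curve_cst (src_submersion G).1 kv' _.
  by apply: filterS st => s [-> _]; rewrite src_one.
exists v', h, (fun s => mul (inv g) (mul (h s) g)); split=> //.
  by rewrite memv_cap v'x andbT; exact: v'E.
apply: filterS3 st cs1 cs2 => s [_ ts] c1 c2; split=> //; first by rewrite c1.
rewrite mulA ?tgt_inv// mulgV.
have -> : tgt g = tgt (mul (h s) g) by rewrite -c2 src_inv.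
by rewrite mul1g.
Qed.

End Groupoid.

(** * The complementary ideal *)

Theorem corollary2p13 (R : realType) (G : lie_groupoid R)
    (k : forall x : objects G, {vspace tangent (one x)}) :
  bundle_of_ideals k -> partially_split k ->
  forall x : objects G,
    isotropy_ideal x (k x) /\
    exists l : {vspace tangent (one x)},
      [/\ isotropy_ideal x l,
          (k x + l)%VS = isotropy_algebra x &
          (k x :&: l)%VS = 0%VS].
Proof.
move=> kb [E [WE split_E]] x.
have [_ ki _] := kb.
split.
  by apply: isotropy_ideal_conj_closed; [exact: ki|
    exact: bundle_of_ideals_conj_closed].
exists (E (one x) :&: isotropy_algebra x)%VS.
have [dec disj] := split_E (one x).
split.
- apply: isotropy_ideal_conj_closed; first exact: capvSr.
  exact: wide_subgroupoid_conj_closed.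
- apply/eqP; rewrite eqEsubv subv_add ki capvSr /=.
  apply/subvP => u ux.
  (* At the unit K is k_x, contained in g_x, so e = u - w is in g_x too: the splitting of the
     tangent space restricts to g_x. *)
  have [e [w [eE /(translated_bundle_one _ ki) wk uE]]] := dec u.
  rewrite uE addrC memv_add// memv_cap eE /=.
  have -> : e = u - w by rewrite uE addrK.
  by rewrite memvB//; exact: (subvP (ki x)).
- apply/eqP; rewrite -subv0; apply/subvP => u.
  rewrite !memv_cap => /andP[uk /andP[uE _]].
  rewrite memv0; apply/eqP/disj => //.
  exact/(translated_bundle_one _ ki).
Qed.
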